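(* Let $\mathbf{a}=(a_i)_{i=1}^\infty$ and $\mathbf{b}=(b_i)_{i=1}^\infty$ be sequences of integers such that $$0=a_1\leq b_1<a_2<b_2<\cdots<a_i<b_i<\cdots.$$ Let $X(\mathbf{a},\mathbf{b})$ be the subset of $[0,1]$ consisting of all those numbers $x$ with an infinite binary expansion $x=\sum_{n=1}^\infty\xi_n2^{-n}$, $\xi_n\in\{0,1\}$, satisfying the condition $$\xi_n=0,\qquad n\in\bigcup_{i=1}^\infty[b_i+1,a_{i+1}].$$ Then: 1. $$\dim_{\mathrm H}X(\mathbf{a},\mathbf{b})=\underline{\dim}_{\mathrm{MB}}X(\mathbf{a},\mathbf{b})=\underline{\dim}_{\mathrm B}X(\mathbf{a},\mathbf{b})=\liminf_{k\to\infty}\frac{\sum_{i=1}^k(b_i-a_i)}{a_{k+1}}.$$ 2. $$\dim_{\mathrm P}X(\mathbf{a},\mathbf{b})=\overline{\dim}_{\mathrm{MB}}X(\mathbf{a},\mathbf{b})=\overline{\dim}_{\mathrm B}X(\mathbf{a},\mathbf{b})=\limsup_{k\to\infty}\frac{\sum_{i=1}^k(b_i-a_i)}{b_k}.$$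
   Context: For integers $p\le q$, $[p,q]$ as a set of indices denotes the integers $n$ with $p\le n\le q$. Convention on binary expansions: digit sequences that are eventually $0$ are allowed, so $X(\mathbf{a},\mathbf{b})$ is the set of all sums $\sum_{n\ge1}\xi_n2^{-n}$ with $\xi_n\in\{0,1\}$ satisfying the stated condition. $\dim_{\mathrm H}$ denotes Hausdorff dimension. For a non-empty bounded set $F\subseteq\mathbb{R}$ and $\varepsilon>0$, let $N_\varepsilon(F)$ be the smallest number of sets of diameter at most $\varepsilon$ which can cover $F$. The lower and upper box dimensions are $$\underline{\dim}_{\mathrm B}F=\liminf_{\varepsilon\to0}\frac{\log N_\varepsilon(F)}{-\log\varepsilon},\qquad \overline{\dim}_{\mathrm B}F=\limsup_{\varepsilon\to0}\frac{\log N_\varepsilon(F)}{-\log\varepsilon}.$$ The modified lower and upper box dimensions are $$\underline{\dim}_{\mathrm{MB}}F=\inf\Big\{\sup_i\underline{\dim}_{\mathrm B}F_i : F\subseteq\bigcup_{i=1}^\infty F_i\Big\},\qquad \overline{\dim}_{\mathrm{MB}}F=\inf\Big\{\sup_i\overline{\dim}_{\mathrm B}F_i : F\subseteq\bigcup_{i=1}^\infty F_i\Big\},$$ the infima being over all countable covers of $F$ by non-empty bounded sets. $\dim_{\mathrm P}$ denotes the standard packing dimension: for $s\ge0$, let $\mathcal{P}^s_\delta(F)$ be the supremum of $\sum_i|B_i|^s$ over countable collections of disjoint balls $B_i$ of radii at most $\delta$ with centers in $F$ ($|B_i|$ being the diameter), $\mathcal{P}^s_0(F)=\lim_{\delta\to0}\mathcal{P}^s_\delta(F)$,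 $\mathcal{P}^s(F)=\inf\{\sum_i\mathcal{P}^s_0(F_i): F\subseteq\bigcup_{i=1}^\infty F_i\}$, and $\dim_{\mathrm P}F=\inf\{s:\mathcal{P}^s(F)=0\}$. *)

(* Defs.v *)
From HB Require Import structures.
From mathcomp Require Import all_boot all_order all_algebra.
From mathcomp Require Import all_classical all_reals all_analysis.
Import Order.TTheory GRing.Theory Num.Theory.
Import numFieldNormedType.Exports.

Set Implicit Arguments.
Unset Strict Implicit.
Unset Printing Implicit Defensive.

Local Open Scope classical_set_scope.
Local Open Scope ring_scope.

Section Dimensions.
Context {R : realType}.
Implicit Types (A F : set R) (s delta eps : R).

(* The diameter of the empty set is -oo, so that the empty set is allowed in
   every cover by sets of diameter at most eps. *)
Definition diam A : \bar R :=
  ereal_sup [set (`|x - y|)%:E | x in A & y in A].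

(* |A|^s; the case distinction only matters for s = 0, where a non-empty set
   contributes 1 and the empty set contributes 0. *)
Definition diam_pow s A : \bar R :=
  if A == set0 then 0%E else poweR (diam A) s.

Definition delta_covers delta F : set (nat -> set R) :=
  [set U | (forall i, (diam (U i) <= delta%:E)%E) /\ F `<=` \bigcup_i U i].

Definition hausdorff_premeasure s delta F : \bar R :=
  ereal_inf [set (\sum_(i <oo) diam_pow s (U i))%E | U in delta_covers delta F].

(* The limit exists: the premeasure is nonincreasing in delta. *)
Definition hausdorff_measure s F : \bar R :=
  lim (hausdorff_premeasure s delta F @[delta --> 0^'+]).

Definition hausdorff_dim F : \bar R :=
  ereal_inf [set s%:E | s in [set s | 0 <= s /\ hausdorff_measure s F = 0%E]].

(* +oo when no finite cover exists, i.e. when F is unbounded. *)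
Definition covering_number eps F : \bar R :=
  ereal_inf [set n%:R%:E | n in [set n : nat | exists U : 'I_n -> set R,
    (forall i, (diam (U i) <= eps%:E)%E) /\ F `<=` \bigcup_i U i]].

Definition box_ratio F eps : \bar R :=
  (lne (covering_number eps F) * ((- ln eps)^-1)%:E)%E.

Definition lower_box_dim F : \bar R := limf_einf (box_ratio F) 0^'+.

Definition upper_box_dim F : \bar R := limf_esup (box_ratio F) 0^'+.

Definition bounded_covers F : set (nat -> set R) :=
  [set G | (forall i, G i !=set0 /\ bounded_set (G i)) /\
           F `<=` \bigcup_i G i].

Definition lower_mbox_dim F : \bar R :=
  ereal_inf [set ereal_sup [set lower_box_dim (G i) | i in [set: nat]]
            | G in bounded_covers F].

Definition upper_mbox_dim F : \bar R :=
  ereal_inf [set ereal_sup [set upper_box_dim (G i) | i in [set: nat]]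
            | G in bounded_covers F].

(* Finite or countable families of pairwise disjoint closed balls
   B(c i, r i), i in J. *)
Definition delta_packings delta F : set (set nat * (nat -> R) * (nat -> R)) :=
  [set p | let: (J, c, r) := p in
    (forall i, J i -> F (c i) /\ 0 < r i <= delta) /\
    trivIset J (fun i => closed_ball (c i) (r i))].

Definition packing_presum s delta F : \bar R :=
  ereal_sup [set (let: (J, c, r) := p in
                  \esum_(i in J) diam_pow s (closed_ball (c i) (r i)))%E
            | p in delta_packings delta F].

(* The limit exists: packing_presum is nondecreasing in delta. *)
Definition packing_premeasure s F : \bar R :=
  lim (packing_presum s delta F @[delta --> 0^'+]).

Definition packing_measure s F : \bar R :=
  ereal_inf [set (\sum_(i <oo) packing_premeasure s (G i))%E
            | G in [set G : nat -> set R | F `<=` \bigcup_i G i]].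

Definition packing_dim F : \bar R :=
  ereal_inf [set s%:E | s in [set s | 0 <= s /\ packing_measure s F = 0%E]].

End Dimensions.

(* Sequences and digits are indexed from 1; the values at index 0 are
   irrelevant. Digit sequences that are eventually 0 are allowed. *)
Definition restricted_digits (R : realType) (a b : nat -> int) : set R :=
  [set x | exists xi : nat -> bool,
     (forall n i : nat, (1 <= i)%N -> b i + 1 <= n%:Z <= a i.+1 ->
        xi n = false) /\
     (\sum_(1 <= n < N) (xi n)%:R * 2 ^- n @[N --> \oo] --> x)].
Arguments restricted_digits R a b : clear implicits.

(* Main.v *)
Require Import Defs.
From mathcomp Require Import all_boot all_order all_algebra.
From mathcomp Require Import all_classical all_reals all_analysis.
From mathcomp Require Import zify ring lra.
Import Order.TTheory GRing.Theory Num.Theory.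
Import numFieldNormedType.Exports.
Set Implicit Arguments.
Unset Strict Implicit.
Unset Printing Implicit Defensive.
Local Open Scope classical_set_scope.
Local Open Scope ring_scope.

(** Let [nfree n] be the number of positions among [1, ..., n] at which a
    digit is free. The set is covered by [2 ^ nfree n] dyadic intervals of
    level [n], so everything is governed by the ratio [nfree n / n]: for an
    arbitrary set of free positions, the Hausdorff and lower box dimensions
    equal the lower limit of this ratio, the packing and upper box dimensions
    its upper limit. For blocks of free positions separated by gaps, the ratio
    decreases along a gap and increases along a block, so its lower limit is
    attained along the ends of the gaps and its upper limit along the ends of
    the blocks ([nfree_ge_of_gap_ends], [nfree_le_of_run_ends]).

    The upper bounds come from the cover by dyadic intervals of one level
    ([digit_set_hausdorff_le], [digit_set_lower_box_dim_le],
    [digit_set_upper_box_dim_le]) and, for the packing dimension, from the fact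
    that balls of a packing with radii of order [2 ^- n] have centres in
    distinct dyadic intervals of level [n + 1] ([digit_set_packing_le]).

    The lower bound for the Hausdorff dimension is the mass distribution
    principle for the measure giving each admissible interval of level [n] the
    mass [2 ^- nfree n]. No measure is constructed: if countably many dyadic
    intervals have total mass below 1, one descends the binary tree, keeping at
    each step the mass of the part still to be avoided below the mass of the
    current interval, and reaches a point outside all of them
    ([avoiding_branch]).

    The remaining lower bounds concern dimensions defined through countable
    covers [G]. A category argument in the tree ([cover_dense_below]) gives a
    piece [G i] and a dyadic interval such that [G i] meets every admissible
    interval inside it. This piece then contains, for each [n], a family of
    [2 ^ (nfree n - c)] points with mutual distances above [2 ^- n.+1]
    ([separated_points]), which bounds its box dimensions and its packing
    premeasure from below. *)

(** * The tree of admissible dyadic words *)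

Section Words.
Variable free : nat -> bool.

Definition nfree n : nat := (\sum_(1 <= i < n.+1) free i)%N.

Lemma nfree0 : nfree 0 = 0%N.
Proof. by rewrite /nfree big_geq. Qed.

Lemma nfreeS n : nfree n.+1 = (nfree n + free n.+1)%N.
Proof. by rewrite /nfree big_nat_recr. Qed.

Lemma nfree_leD n m : (nfree n <= nfree (n + m) <= nfree n + m)%N.
Proof.
elim: m => [|m /andP[IH1 IH2]]; first by rewrite !addn0 !leqnn.
by rewrite addnS nfreeS; case: free; lia.
Qed.

Lemma nfree_mono n m : (n <= m)%N -> (nfree n <= nfree m)%N.
Proof. by move=> nm; have := nfree_leD n (m - n); rewrite subnKC // => /andP[]. Qed.

Lemma nfree_leq n : (nfree n <= n)%N.
Proof. by have := nfree_leD 0 n; rewrite nfree0 add0n => /andP[]. Qed.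

(** The words are encoded by integers: the word [j] of level [n] stands for
    the dyadic interval from [j / 2 ^ n] to [j.+1 / 2 ^ n], its last digit is
    [odd j] and its parent is [j./2]. The list [desc n k m] enumerates the
    admissible words of level [n + m] below the word [k] of level [n]. *)
Fixpoint desc (n k m : nat) : seq nat :=
  if m is m'.+1 then
    [seq ((e : bool) + j.*2)%N
      | j <- desc n k m', e <- if free (n + m) then [:: false; true] else [:: false]]
  else [:: k].

Lemma mem_descS n k m j :
  (j \in desc n k m.+1) = (j./2 \in desc n k m) && (odd j ==> free (n + m.+1)).
Proof.
apply/allpairsP/andP => [[[i e] /= [hi he ->]]|[hj ho]].
  rewrite half_bit_double hi oddD odd_double addbF oddb; split=> //.
  by move: he; case: (free _) => //; rewrite ?inE; case: e.
exists (j./2, odd j); split=> //=; last by rewrite odd_double_half.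
by move: ho; case: (odd j); case: (free _).
Qed.

Lemma desc_uniq n k m : uniq (desc n k m).
Proof.
elim: m => //= m IH; apply: allpairs_uniq => //; first by case: free.
move=> [i e] [i' e'] _ _ /= h.
have := congr1 half h; rewrite !half_bit_double => ->.
by have := congr1 odd h; rewrite !oddD !odd_double !addbF !oddb => ->.
Qed.

Lemma size_desc n k m : (size (desc n k m) * 2 ^ nfree n = 2 ^ nfree (n + m))%N.
Proof.
elim: m => [|m IH]; first by rewrite addn0 mul1n.
rewrite /= size_allpairs addnS nfreeS expnD -IH.
by case: free => /=; lia.
Qed.

Definition words n := desc 0 0 n.

Lemma mem_wordsS n j :
  (j \in words n.+1) = (j./2 \in words n) && (odd j ==> free n.+1).
Proof. exact: mem_descS. Qed.

Lemma size_words n : size (words n) = (2 ^ nfree n)%N.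
Proof. by have := size_desc 0 0 n; rewrite nfree0 expn0 muln1. Qed.

Lemma words0 j : (j \in words 0) = (j == 0)%N.
Proof. by rewrite inE. Qed.

Lemma half_divn_exp j m : ((j./2) %/ 2 ^ m = j %/ 2 ^ m.+1)%N.
Proof. by rewrite -divn2 -divnMA expnS. Qed.

Lemma mem_desc n k m j : k \in words n ->
  (j \in desc n k m) = (j \in words (n + m)) && (j %/ 2 ^ m == k)%N.
Proof.
move=> kw; elim: m j => [|m IH] j.
  rewrite inE addn0 expn0 divn1; case: eqP => [->|]; rewrite ?andbF ?andbT //.
rewrite mem_descS addnS mem_wordsS IH half_divn_exp -!andbA; congr (_ && _).
by rewrite andbC.
Qed.

Lemma words_double n k : k \in words n -> k.*2 \in words n.+1.
Proof. by rewrite mem_wordsS doubleK odd_double => ->. Qed.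

Lemma words_doubleS n k : free n.+1 -> k \in words n -> k.*2.+1 \in words n.+1.
Proof. by rewrite mem_wordsS /= uphalf_double odd_double => -> ->. Qed.

Lemma words_ancestor n m j : j \in words (n + m) -> (j %/ 2 ^ m)%N \in words n.
Proof.
elim: m j => [|m IH] j; first by rewrite addn0 expn0 divn1.
by rewrite addnS mem_wordsS => /andP[/IH + _]; rewrite half_divn_exp.
Qed.

Definition branch (p : nat -> nat) :=
  forall n, p n \in words n /\ (p n.+1)./2 = p n.

Lemma branch_ancestor p n m : branch p -> (p (n + m) %/ 2 ^ m = p n)%N.
Proof.
move=> bp; elim: m => [|m IH]; first by rewrite addn0 expn0 divn1.
by rewrite -half_divn_exp addnS (bp _).2.
Qed.

(** The limit of an increasing sequence of words, [w j] being a word of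
    level [l j] above [w j.+1]. The levels have to tend to infinity, which
    [j <= l j] ensures. *)
Lemma branch_of_chain (l w : nat -> nat) :
  (forall j, (j <= l j)%N) -> (forall j, w j \in words (l j)) ->
  (forall j, (l j <= l j.+1)%N /\ (w j.+1 %/ 2 ^ (l j.+1 - l j) = w j)%N) ->
  exists2 p, branch p & forall j, p (l j) = w j.
Proof.
move=> lj ww hs.
have l_mono i d : (l i <= l (i + d))%N /\ (w (i + d) %/ 2 ^ (l (i + d) - l i) = w i)%N.
  elim: d => [|d [IH1 IH2]]; first by rewrite addn0 subnn expn0 divn1.
  rewrite addnS; have [h1 h2] := hs (i + d)%N; split; first exact: leq_trans h1.
  rewrite -[RHS]IH2 -h2 -divnMA -expnD; congr (_ %/ 2 ^ _)%N; lia.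
have key i j n : (n <= l i)%N -> (n <= l j)%N ->
    (w i %/ 2 ^ (l i - n) = w j %/ 2 ^ (l j - n))%N.
  wlog ij : i j / (i <= j)%N => [hw ni nj|ni nj].
    by have [/hw|/ltnW/hw] := leqP i j => [->|<-].
  have [h1 h2] := l_mono i (j - i)%N; rewrite subnKC // in h1 h2.
  rewrite -h2 -divnMA -expnD; congr (_ %/ 2 ^ _)%N; lia.
(* [w n] has level at least [n], so its ancestor at level [n] is defined. *)
exists (fun n => w n %/ 2 ^ (l n - n))%N => [n|j]; last first.
  by rewrite (key (l j) j (l j)) // subnn expn0 divn1.
split; first by apply: words_ancestor; rewrite subnKC.
rewrite -divn2 -divnMA -(expnSr 2 _).
rewrite -(key n.+1 n n) //; last exact: leq_trans (lj _).
by congr (_ %/ 2 ^ _)%N; have := lj n.+1; lia.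
Qed.

End Words.

(** * Dyadic intervals and points of the digit set *)

Section Points.
Variables (R : realType) (free : nat -> bool).

(** The inequalities are multiplied by [2 ^+ n] to avoid divisions. *)
Definition cell n k : set R := [set x | k%:R <= x * 2 ^+ n <= k.+1%:R].

Lemma cell_ancestor n m k : cell (n + m) k `<=` cell n (k %/ 2 ^ m)%N.
Proof.
move=> x; rewrite /cell /= exprD mulrA => /andP[h1 h2].
have p0 : 0 < 2 ^+ m :> R by rewrite exprn_gt0.
apply/andP; split.
  rewrite -(ler_pM2r p0) (le_trans _ h1) // -natrX -natrM ler_nat.
  exact: leq_divM.
rewrite -(ler_pM2r p0) (le_trans h2) // -natrX -natrM ler_nat.
by rewrite -ltn_divLR // expn_gt0.
Qed.

Lemma cell_close n k x y : cell n k x -> cell n k y -> `|x - y| <= 2 ^- n.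
Proof.
move=> /andP[x1 x2] /andP[y1 y2].
have p0 : 0 < 2 ^+ n :> R by rewrite exprn_gt0.
rewrite -(ler_pM2r p0) mulVf ?gt_eqF // -{1}(gtr0_norm p0) -normrM mulrBl.
by move: x2 y2; rewrite -(natr1 k) => x2 y2; rewrite ler_norml; apply/andP; split; lra.
Qed.

Definition digit_set : set R :=
  [set x | exists xi : nat -> bool,
     (forall n, (0 < n)%N -> ~~ free n -> xi n = false) /\
     (\sum_(1 <= n < N) (xi n)%:R * 2 ^- n @[N --> \oo] --> x)].

(** A point determines its branch only up to the two expansions of dyadic
    rationals; closed cells make the statement true for either of them. *)
Lemma digit_set_branch x : digit_set x <->
  exists2 p, branch free p & forall n, cell n (p n) x.
Proof.
have p0 n : 0 < 2 ^+ n :> R by rewrite exprn_gt0.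
split=> [[xi [xif xic]]|[p bp px]].
  pose fix p n := if n is m.+1 then (xi n + (p m).*2)%N else 0%N.
  have bp : branch free p.
    move=> n; split=> /=; last by rewrite half_bit_double.
    elim: n => [|n IH]; first by rewrite words0.
    rewrite mem_wordsS /= half_bit_double IH oddD odd_double addbF oddb /=.
    by apply/implyP=> h; apply: contraPT h => /xif ->.
  have sE N : \sum_(1 <= n < N.+1) (xi n)%:R * 2 ^- n = (p N)%:R * 2 ^- N :> R.
    elim: N => [|N IH]; first by rewrite big_geq //= mul0r.
    rewrite big_nat_recr //= IH natrD -muln2 natrM exprS.
    by field; rewrite expf_neq0.
  exists p => // n.
  have xic' : (\sum_(1 <= k < (N + n).+1) (xi k)%:R * 2 ^- k @[N --> \oo] --> x).
    by rewrite -(cvg_shiftn n.+1) in xic; under eq_fun do rewrite -addnS.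
  have hN N : cell n (p n) ((p (N + n)%N)%:R * 2 ^- (N + n)).
    rewrite [(N + n)%N]addnC -(branch_ancestor n N bp); apply: cell_ancestor.
    by rewrite /cell /= divfK ?gt_eqF// lexx ler_nat /=.
  apply/andP; split.
    rewrite -ler_pdivrMr //; apply: (cvgr_to_ge xic'); near=> N.
    by rewrite sE ler_pdivrMr //; case/andP: (hN N).
  rewrite -ler_pdivlMr //; apply: (cvgr_to_le xic'); near=> N.
  by rewrite sE ler_pdivlMr //; case/andP: (hN N).
exists (fun n => odd (p n)); split.
  case=> // n _ /negPf fn.
  have := (bp n.+1).1; rewrite mem_wordsS fn implybF => /andP[_ /negPf].
  exact.
have sE N : \sum_(1 <= n < N.+1) (odd (p n))%:R * 2 ^- n = (p N)%:R * 2 ^- N :> R.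
  elim: N => [|N IH].
    by rewrite big_geq //=; have := (bp 0).1; rewrite words0 => /eqP ->; rewrite mul0r.
  rewrite big_nat_recr //= IH -{2}[p N.+1]odd_double_half (bp N).2 natrD -muln2 natrM exprS.
  by field; rewrite expf_neq0.
rewrite -(cvg_shiftn 1) /=; under eq_fun do rewrite addn1 sE.
apply/cvgrPdist_le => e e0; near=> N.
have hN : `|x - (p N)%:R / 2 ^+ N| <= 2 ^- N.
  apply: (@cell_close N (p N)) => //.
  by rewrite /cell /= divfK ?gt_eqF// lexx ler_nat /=.
apply: le_trans hN _; rewrite -exprVn.
near: N.
have : (fun n => (2^-1 : R) ^+ n) @ \oo --> (0 : R).
  by apply: cvg_expr; rewrite gtr0_norm ?invr_gt0 // invf_lt1 // ltr1n.
move/cvgr0Pnorm_le => /(_ _ e0); apply: filterS => n.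
by rewrite ger0_norm // exprn_ge0.
Unshelve. all: by end_near.
Qed.

Lemma digit_set_cell x n : digit_set x -> exists2 k, k \in words free n & cell n k x.
Proof. by move=> /digit_set_branch [p /(_ n)[pw _] px]; exists (p n). Qed.

Lemma branch_point p : branch free p ->
  exists2 x, digit_set x & forall n, cell n (p n) x.
Proof.
move=> bp.
have p0 n : 0 < 2 ^+ n :> R by rewrite exprn_gt0.
pose u n : R := (p n)%:R / 2 ^+ n.
have uc n m : cell n (p n) (u (n + m)%N).
  rewrite -(branch_ancestor n m bp); apply: cell_ancestor.
  by rewrite /cell /= divfK ?gt_eqF// lexx ler_nat /=.
have u_nd : nondecreasing_seq u.
  move=> n m nm; have := uc n (m - n)%N; rewrite subnKC // => /andP[h _].
  by rewrite /u ler_pdivrMr.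
have u_ub n m : u m <= (p n).+1%:R / 2 ^+ n.
  apply: (@le_trans _ _ (u (n + m)%N)); first by apply: u_nd; rewrite leq_addl.
  by rewrite ler_pdivlMr //; case/andP: (uc n m).
have u_cvg : cvgn u.
  apply: nondecreasing_is_cvgn => //; exists ((p 0).+1%:R / 2 ^+ 0) => _ [n _ <-].
  exact: u_ub.
have px n : cell n (p n) (limn u).
  apply/andP; split.
    by rewrite -ler_pdivrMr //; exact: nondecreasing_cvgn_le.
  by rewrite -ler_pdivlMr //; apply: limr_le => //; near=> m; exact: u_ub.
by exists (limn u) => //; apply/digit_set_branch; exists p.
Unshelve. all: by end_near.
Qed.

End Points.

Arguments cell : clear implicits.
Arguments digit_set : clear implicits.

(** * Category and mass arguments in the tree *)

Section Trees.
Variables (R : realType) (free : nat -> bool).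
Local Notation X := (digit_set R free).
Local Notation M := (nfree free).

(** Density of [G] in the part of the digit set below the word [k] of level
    [n], in terms of the tree. *)
Definition dense_below (G : set R) n k :=
  forall m j, j \in desc free n k m -> exists2 y, G y & cell R (n + m) j y.

(** The Baire category theorem for a digit set. Were no [G i] dense below any
    word, one could successively pass to a word below the previous one whose
    cell avoids [G i], for i = 0, 1, ...; the limit of these words is a point
    of the set outside all the [G i]. *)
Lemma cover_dense_below (G : nat -> set R) : X `<=` \bigcup_i G i ->
  exists i n k, k \in words free n /\ dense_below (G i) n k.
Proof.
move=> XG; apply: contrapT => hno.
have step (iw : nat * (nat * nat)) : exists w : nat * nat,
    iw.2.2 \in words free iw.2.1 ->
    [/\ w.2 \in words free w.1, (iw.2.1 < w.1)%N,
        (w.2 %/ 2 ^ (w.1 - iw.2.1))%N = iw.2.2 &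
        forall y, G iw.1 y -> ~ cell R w.1 w.2 y].
  case: iw => i [n k] /=; have [kw|_] := boolP (k \in words free n); last first.
    by exists (0, 0)%N.
  apply: contrapT => hn; apply: hno; exists i, n, k; split => // m j jd.
  (* Going to the child [j.*2] of [j] makes the level increase even if [m = 0]. *)
  apply: contrapT => hy; apply: hn; exists (n + m.+1, j.*2)%N => _ /=.
  move: jd; rewrite mem_desc // => /andP[jw /eqP jk].
  have j2 : (j.*2 %/ 2 ^ 1)%N = j by rewrite expn1 divn2 doubleK.
  split.
  - by rewrite addnS words_double.
  - by rewrite addnS ltnS leq_addr.
  - by rewrite addnC addnK expnS divnMA divn2 doubleK.
  - move=> y Gy; rewrite addnS -addn1 => /(@cell_ancestor R); rewrite j2 => cy.
    by apply: hy; exists y.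
have [f fP] := choice step.
pose fix W i := if i is i'.+1 then f (i', W i') else (0, 0)%N.
have Ww i : (W i).2 \in words free (W i).1.
  by elim: i => [|i IH] //=; case: (fP (i, W i) IH).
have lt i : ((W i).1 < (W i.+1).1)%N by case: (fP (i, W i) (Ww i)).
have [||| p bp pW] := @branch_of_chain free (fun i => (W i).1) (fun i => (W i).2).
- by elim=> [|i IH] //; apply: leq_ltn_trans (lt i).
- exact: Ww.
- by move=> i; split; [exact: ltnW | case: (fP (i, W i) (Ww i))].
have [x Xx xp] := branch_point R bp.
have [i _ Gx] := XG x Xx.
have [_ _ _ /(_ x Gx)] := fP (i, W i) (Ww i); apply.
by have := xp (W i.+1).1; rewrite pW.
Qed.

(** The mass of the part, below the word [k] of level [n], of the set of
    points lying below one of the words of [A], which have level [L]. If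
    [n <= L], those words are counted with multiplicity; otherwise [k] lies
    entirely inside or outside. *)
Definition mass (L : nat) (A : seq nat) (n k : nat) : R :=
  if (n <= L)%N then (count (fun j => j %/ 2 ^ (L - n) == k)%N A)%:R * 2 ^- M L
  else (k %/ 2 ^ (n - L) \in A)%N%:R * 2 ^- M n.

Lemma mass_ge0 L A n k : 0 <= mass L A n k.
Proof. by rewrite /mass; case: ifP => _; rewrite mulr_ge0 ?invr_ge0 ?exprn_ge0. Qed.

Lemma mass_root L A : mass L A 0 0 <= (size A)%:R * 2 ^- M L.
Proof. by rewrite /mass leq0n ler_wpM2r ?invr_ge0 ?exprn_ge0 // ler_nat count_size. Qed.

Lemma mass_ge L (A : seq nat) n k : (L <= n)%N -> (k %/ 2 ^ (n - L))%N \in A ->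
  2 ^- M n <= mass L A n k.
Proof.
rewrite leq_eqVlt => /predU1P[<-|nL] kA.
  rewrite /mass leqnn subnn ler_peMl ?invr_ge0 ?exprn_ge0 // ler1n -has_count.
  rewrite subnn expn0 divn1 in kA.
  by apply/hasP; exists k; rewrite //= expn0 divn1.
by rewrite /mass leqNgt nL /= kA mul1r.
Qed.

(** The mass is additive along the tree, up to repetitions in [A] and
    elements of [A] that are not admissible, which only help. *)
Lemma mass_children L A n k :
  mass L A n.+1 k.*2 + (free n.+1)%:R * mass L A n.+1 k.*2.+1 <= mass L A n k.
Proof.
have [nL|Ln] := ltnP n L.
  rewrite /mass nL (ltnW nL) mulrA -mulrDl ler_wpM2r ?invr_ge0 ?exprn_ge0 //.
  rewrite -natrM -natrD ler_nat.
  set a := count _ _; set b := count _ _; apply: (@leq_trans (a + b)%N).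
    by rewrite leq_add2l; case: free; rewrite ?mul1n.
  rewrite /a /b -count_predUI [X in (_ + X)%N](_ : _ = 0)%N ?addn0.
    apply: sub_count => j /=.
    have -> : (L - n = (L - n.+1).+1)%N by rewrite -subSn.
    rewrite expnSr divnMA divn2 => /orP[] /eqP ->; first by rewrite doubleK.
    by rewrite /= uphalf_double.
  apply/eqP; rewrite -[_ == _]negbK -lt0n -has_count.
  by apply/hasPn => j _ /=; apply/negP => /andP[/eqP ->] /eqP /(congr1 odd); rewrite /= odd_double.
have e2 (e : bool) : ((e + k.*2) %/ 2 ^ (n.+1 - L) = k %/ 2 ^ (n - L))%N.
  by rewrite subSn // expnS divnMA divn2 half_bit_double.
rewrite {1 2}/mass ltnNge Ln /= (e2 false) (e2 true).
have [kA|_] := boolP (_ \in A); last by rewrite !mul0r mulr0 addr0 mass_ge0.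
apply: le_trans (mass_ge Ln kA); rewrite !mul1r nfreeS exprD.
case: free; rewrite ?mul0r ?addr0 ?mulr1 // mul1r expr1.
by rewrite le_eqVlt; apply/orP; left; apply/eqP; field; rewrite expf_neq0.
Qed.

(** Mass distribution on the tree, without a measure: words of total mass
    below 1 do not exhaust the branches, because some child always inherits
    the strict inequality between the mass to avoid and its own mass. *)
Lemma avoiding_branch (L : nat -> nat) (A : nat -> seq nat) :
  (\sum_(j <oo) ((size (A j))%:R * 2 ^- M (L j) : R)%:E < 1)%E ->
  exists2 p, branch free p & forall j, p (L j) \notin A j.
Proof.
move=> sum1.
pose F n k : \bar R := (\sum_(j <oo) (mass (L j) (A j) n k)%:E)%E.
have F0 n k j : (0 <= (mass (L j) (A j) n k)%:E)%E by rewrite lee_fin mass_ge0.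
pose inv n k := k \in words free n /\ (F n k < (2 ^- M n)%:E)%E.
have inv0 : inv 0%N 0%N.
  split=> //; rewrite nfree0 expr0 invr1; apply: le_lt_trans sum1.
  by apply: lee_nneseries => // j _; rewrite lee_fin mass_root.
have step (nk : nat * nat) : exists k', inv nk.1 nk.2 -> k'./2 = nk.2 /\ inv nk.1.+1 k'.
  case: nk => n k /=; apply: contrapT => hno.
  have [[kw]|hinv] := pselect (inv n k); last by apply: hno; exists 0%N.
  apply/negP; rewrite -leNgt.
  have c0 : ((2 ^- M n.+1)%:E <= F n.+1 k.*2)%E.
    rewrite leNgt; apply/negP => h; apply: hno; exists k.*2 => _.
    by rewrite doubleK; split=> //; split=> //; exact: words_double.
  have c1 : free n.+1 -> ((2 ^- M n.+1)%:E <= F n.+1 k.*2.+1)%E.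
    move=> fn; rewrite leNgt; apply/negP => h; apply: hno; exists k.*2.+1 => _.
    by rewrite /= uphalf_double; split=> //; split=> //; exact: words_doubleS.
  have FF : (F n.+1 k.*2 + (free n.+1)%:R%:E * F n.+1 k.*2.+1 <= F n k)%E.
    rewrite /F -nneseriesZl // -nneseriesD //; last first.
      by move=> j _ _; rewrite mule_ge0 // lee_fin.
    apply: lee_nneseries => j _; last first.
      by rewrite -EFinM -EFinD lee_fin; exact: mass_children.
    by move=> _; rewrite adde_ge0 // mule_ge0 // lee_fin.
  apply: le_trans FF; move: c0 c1; rewrite nfreeS.
  case: (free n.+1) => c0 c1; last by rewrite mul0e adde0; rewrite addn0 in c0.
  rewrite mul1e; apply: le_trans (leeD c0 (c1 isT)).
  rewrite -EFinD lee_fin le_eqVlt; apply/orP; left; apply/eqP.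
  by rewrite addn1 exprS; field; rewrite expf_neq0.
have [f fP] := choice step.
pose fix p n := if n is m.+1 then f (m, p m) else 0%N.
have pinv n : inv n (p n) by elim: n => [|n IH] //=; case: (fP (n, p n) IH).
exists p => [n|j]; first by split; [exact: (pinv n).1 | case: (fP (n, p n) (pinv n))].
apply/negP => pA.
have := (pinv (L j)).2; apply/negP; rewrite -leNgt.
apply: (@le_trans _ _ (mass (L j) (A j) (L j) (p (L j)))%:E).
  by rewrite lee_fin mass_ge // subnn expn0 divn1.
have := @nneseries_lim_ge R (fun i => (mass (L i) (A i) (L j) (p (L j)))%:E) xpredT 0 j.+1
  (fun i _ _ => F0 _ _ _).
apply: le_trans; rewrite big_nat_recr //= leeDr //.
by apply: sume_ge0.
Qed.

(** A gap between the points is what bounds covering numbers and packings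
    from below, whereas points of neighbouring cells could coincide. It is
    obtained by choosing the point for the word [j] in the cell of the
    descendant of [j] with two more digits, both zero: such points are at
    least 3/4 of a cell apart. *)
Lemma separated_points (G : set R) n k : k \in words free n ->
  dense_below G n k ->
  forall m, exists x : nat -> R,
    (forall j, j \in desc free n k m -> G (x j)) /\
    {in desc free n k m &, forall i j, i != j -> 2 ^- (n + m).+1 < `|x i - x j|}.
Proof.
move=> kw hG m.
(* Appending two zero digits keeps the points in the first quarter of their cells. *)
have step (j : nat) : exists y, j \in desc free n k m ->
    G y /\ cell R (n + m).+2 j.*2.*2 y.
  have [jd|_] := boolP (j \in desc free n k m); last by exists 0.
  have [|y Gy cy] := hG m.+2 j.*2.*2.
    by rewrite !mem_descS !doubleK jd /= !odd_double.
  by exists y => _; split; rewrite // -!addnS.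
have [x xP] := choice step.
exists x; split=> [j /xP[]//|].
have key i j : i \in desc free n k m -> j \in desc free n k m -> (i < j)%N ->
    2 ^- (n + m).+1 < x j - x i.
  move=> /xP[_ /andP[_ i2]] /xP[_ /andP[j1 _]] ij.
  have p0 : 0 < 2 ^+ (n + m).+2 :> R by rewrite exprn_gt0.
  rewrite -(ltr_pM2r p0) mulrBl.
  have -> : 2 ^- (n + m).+1 * 2 ^+ (n + m).+2 = 2 :> R.
    by rewrite [2 ^+ _.+2]exprS mulrCA mulVf ?mulr1 // expf_neq0.
  have : (i.*2.*2.+1 + 3 <= j.*2.*2)%N by lia.
  rewrite -(ler_nat R) natrD => ij4; lra.
move=> i j id jd; rewrite neq_ltn => /orP[] ij; last exact: lt_le_trans (key _ _ _ _ ij) (ler_norm _).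
by rewrite distrC; exact: lt_le_trans (key _ _ _ _ ij) (ler_norm _).
Qed.

End Trees.

(** * Powers of two, diameters and the Hausdorff dimension *)

Section Aux.
Variable R : realType.
Implicit Types (s d : R) (A F : set R).

Lemma pow2Nn n : 2 ^- n = 2 `^ (- n%:R) :> R.
Proof. by rewrite powR_invn. Qed.

Lemma pow2n n : 2 ^+ n = 2 `^ n%:R :> R.
Proof. by rewrite powR_mulrn. Qed.

Lemma pow2D (x y : R) : 2 `^ (x + y) = 2 `^ x * 2 `^ y :> R.
Proof. by rewrite powRD // pnatr_eq0 implybT. Qed.

Lemma pow2Nn_gt0 n : 0 < 2 ^- n :> R.
Proof. by rewrite invr_gt0 exprn_gt0. Qed.

Lemma pow2Nn_lt1 n : (0 < n)%N -> 2 ^- n < 1 :> R.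
Proof. by move=> n0; rewrite invf_lt1 ?exprn_gt0 // exprn_egt1 ?ltr1n // -lt0n. Qed.

Lemma ln2_gt0 : 0 < ln (2 : R). Proof. by rewrite ln_gt0 // ltr1n. Qed.

Lemma ln_pow2Nn n : - ln (2 ^- n) = n%:R * ln 2 :> R.
Proof. by rewrite pow2Nn ln_powR mulNr opprK. Qed.

Lemma pow2Nn_powR n s : (2 ^- n) `^ s = 2 `^ (- (s * n%:R)) :> R.
Proof. by rewrite pow2Nn -powRrM mulNr mulrC. Qed.

Lemma ler_pow2 (x y : R) : x <= y -> 2 `^ x <= 2 `^ y :> R.
Proof. by apply: ler_powR; rewrite ler1n. Qed.

Lemma archi_nat (x : R) : exists n0, forall n, (n0 <= n)%N -> x <= n%:R.
Proof.
exists (Num.trunc x).+1 => n hn; apply: (le_trans (ltW (truncnS_gt x))).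
by rewrite ler_nat.
Qed.

Lemma archi_nat_mul c (x : R) : 0 < c -> exists n0, forall n, (n0 <= n)%N -> x <= c * n%:R.
Proof.
move=> c0; have [n0 h] := archi_nat (x / c); exists n0 => n /h.
by rewrite ler_pdivrMr // mulrC.
Qed.

Lemma pow2_small c (e : R) : 0 < c -> 0 < e ->
  exists n0, forall n, (n0 <= n)%N -> 2 `^ (- (c * n%:R)) <= e.
Proof.
move=> c0 e0; have l2 : 0 < ln (2 : R) by rewrite ln_gt0 // ltr1n.
have [n0 h] := archi_nat_mul (- ln e) (mulr_gt0 c0 l2); exists n0 => n /h.
rewrite -(ler_ln (x := 2 `^ _)) ?posrE ?powR_gt0 // ln_powR mulNr.
by rewrite mulrAC; lra.
Qed.

Lemma pow2Nn_small (e : R) : 0 < e -> exists n0, forall n, (n0 <= n)%N -> 2 ^- n <= e.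
Proof.
move=> e0; have [n0 h] := pow2_small ltr01 e0; exists n0 => n /h.
by rewrite mul1r pow2Nn.
Qed.

Lemma ler_pow2Nn n m : (n <= m)%N -> 2 ^- m <= 2 ^- n :> R.
Proof. by move=> nm; rewrite !pow2Nn ler_pow2 // lerN2 ler_nat. Qed.

(** The exponent is unique: it is the largest one with [d <= 2 ^- n]. *)
Lemma dyadic_scale n0 d : 0 < d <= 2 ^- n0 ->
  exists2 n, (n0 <= n)%N & 2 ^- n.+1 < d <= 2 ^- n.
Proof.
move=> /andP[d0 dn0].
have [N hN] := pow2Nn_small d0.
have exn : exists n, d <= 2 ^- n by exists n0.
have ubn n : d <= 2 ^- n -> (n <= N)%N.
  move=> dn; rewrite leqNgt; apply/negP => Nn.
  have := le_trans dn (le_trans (ler_pow2Nn Nn) (lexx _)).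
  have := hN N (leqnn _); rewrite exprS invfM.
  have : 0 < 2 ^- N :> R by rewrite invr_gt0 exprn_gt0.
  lra.
case: (ex_maxnP exn ubn) => n dn nmax; exists n; first exact: nmax.
by rewrite dn andbT ltNge; apply/negP => /nmax; rewrite ltnn.
Qed.

Lemma diam_leP A d : (diam A <= d%:E)%E <-> forall x y, A x -> A y -> `|x - y| <= d.
Proof.
split=> [h x y Ax Ay|h].
  by rewrite -lee_fin; apply: le_trans h; apply: ereal_sup_ubound; exists x => //; exists y.
by apply: ge_ereal_sup => _ [x Ax [y Ay <-]]; rewrite lee_fin h.
Qed.

Lemma diam_ge0 A : A !=set0 -> (0 <= diam A)%E.
Proof.
by move=> [x Ax]; apply: ereal_sup_ubound; exists x => //; exists x => //; rewrite subrr normr0.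
Qed.

Lemma diam_fin A d : A !=set0 -> (diam A <= d%:E)%E ->
  exists2 r : R, 0 <= r <= d & diam A = r%:E.
Proof.
move=> /diam_ge0; case: (diam A) => [r| |] //.
by rewrite !lee_fin => r0 rd; exists r => //; rewrite r0.
Qed.

Lemma diam_pow_ge0 s A : (0 <= diam_pow s A)%E.
Proof. by rewrite /diam_pow; case: ifP => // _; exact: poweR_ge0. Qed.

Lemma diam_pow_set0 s : diam_pow s (@set0 R) = 0%E.
Proof. by rewrite /diam_pow eqxx. Qed.

Lemma diam_powE s A r : A !=set0 -> diam A = r%:E -> diam_pow s A = (r `^ s)%:E.
Proof. by move=> /set0P/negPf A0 Ar; rewrite /diam_pow A0 Ar poweR_EFin. Qed.

Lemma diam_pow_le s A d : 0 <= s -> (diam A <= d%:E)%E -> (diam_pow s A <= (d `^ s)%:E)%E.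
Proof.
move=> s0; have [->|/set0P A0] := eqVneq A set0; first by rewrite diam_pow_set0 lee_fin powR_ge0.
move=> /(diam_fin A0)[r /andP[r0 rd] Ar]; rewrite (diam_powE s A0 Ar) lee_fin.
by rewrite ge0_ler_powR ?nnegrE // (le_trans r0).
Qed.

Lemma diam_set0 (d : R) : (diam (@set0 R) <= d%:E)%E.
Proof. by apply/diam_leP => x y []. Qed.

Lemma sum_eventually0 (f : nat -> \bar R) N : (forall i, (0 <= f i)%E) ->
  (forall i, (N <= i)%N -> f i = 0%E) -> (\sum_(i <oo) f i = \sum_(0 <= i < N) f i)%E.
Proof.
move=> f0 fN; rewrite (nneseries_split 0 N) // eseries0 ?adde0 // => i.
by rewrite add0n => /fN.
Qed.

(** The premeasure is nonincreasing in [d], so the limit at 0 is a supremum. *)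
Lemma hausdorff_measureE s F :
  hausdorff_measure s F = ereal_sup [set hausdorff_premeasure s d F | d in [set d : R | 0 < d]].
Proof.
rewrite /hausdorff_measure.
have := @nonincreasing_at_right_cvge R (fun d => hausdorff_premeasure s d F) 0 +oo%O isT.
have -> : [set` Interval (BRight 0) +oo%O] = [set d : R | 0 < d].
  by apply/seteqP; split=> x; rewrite /= in_itv /= andbT.
move=> h; apply/cvg_lim => //; apply: h => a b _ _ ab.
apply: ereal_inf_le_tmp => _ [U [Ud FU] <-]; exists U => //; split => // i.
by apply: le_trans (Ud i) _; rewrite lee_fin.
Qed.

Lemma hausdorff_premeasure_ge0 s d F : (0 <= hausdorff_premeasure s d F)%E.
Proof.
apply: le_ereal_inf_tmp => _ [U _ <-]; apply: nneseries_ge0 => i _ _; exact: diam_pow_ge0.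
Qed.

(** Since the measure is the supremum of the premeasures, one positive
    premeasure for each smaller exponent suffices. *)
Lemma hausdorff_dim_ge F s :
  (forall s', 0 <= s' < s -> exists d c : R, [/\ 0 < d, 0 < c &
     (c%:E <= hausdorff_premeasure s' d F)%E]) -> (s%:E <= hausdorff_dim F)%E.
Proof.
move=> h; apply: le_ereal_inf_tmp => _ [s' [s'0 Hs'] <-]; rewrite lee_fin leNgt.
apply/negP => ss'; have [|d [c [d0 c0]]] := h s'; first by rewrite s'0.
move=> hc; have : (c%:E <= hausdorff_measure s' F)%E.
  apply: (le_trans hc); rewrite hausdorff_measureE; apply: ereal_sup_ubound.
  by exists d.
by rewrite Hs' lee_fin leNgt c0.
Qed.

Lemma hausdorff_dim_le F s : 0 <= s ->
  (forall s' d, s < s' -> 0 < d -> (hausdorff_premeasure s' d F <= 0)%E) ->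
  (hausdorff_dim F <= s%:E)%E.
Proof.
move=> s0 h; apply/lee_addgt0Pr => e e0; apply: ereal_inf_lbound.
exists (s + e) => //; split; first by rewrite addr_ge0 // ltW.
rewrite hausdorff_measureE; apply/eqP; rewrite eq_le; apply/andP; split.
  by apply: ge_ereal_sup => _ [d d0 <-]; apply: h => //; rewrite ltrDl.
apply: le_ereal_sup_tmp; exists (hausdorff_premeasure (s + e) 1 F).
  by exists 1 => //=.
exact: hausdorff_premeasure_ge0.
Qed.

Lemma hausdorff_dim_ge0 F : (0 <= hausdorff_dim F)%E.
Proof. by apply: le_ereal_inf_tmp => _ [s [s0 _] <-]; rewrite lee_fin. Qed.

End Aux.

(** * Hausdorff dimension of a digit set *)

Section Hausdorff.
Variables (R : realType) (free : nat -> bool).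
Local Notation X := (digit_set R free).
Local Notation M := (nfree free).
Implicit Types s : R.

Lemma diam_cell n k : (diam (cell R n k) <= (2 ^- n)%:E)%E.
Proof. by apply/diam_leP => x y; exact: cell_close. Qed.

Lemma words_cover n :
  let U i := if (i < size (words free n))%N then cell R n (nth 0%N (words free n) i) else set0 in
  X `<=` \bigcup_i U i.
Proof.
move=> U x /(@digit_set_cell R free _ n)[k kw cx].
by exists (index k (words free n)) => //; rewrite /U index_mem kw nth_index.
Qed.

(** The cover by the [2 ^ M n] admissible cells of level [n]. *)
Lemma digit_set_premeasure_le n s d : 0 <= s -> 2 ^- n <= d ->
  (hausdorff_premeasure s d X <= (2 `^ ((M n)%:R - s * n%:R))%:E)%E.
Proof.
move=> s0 nd; set U := (fun i => if (i < size (words free n))%N then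
   cell R n (nth 0%N (words free n) i) else set0).
have Ud i : (diam (U i) <= (2 ^- n)%:E)%E.
  by rewrite /U; case: ifP => _; [exact: diam_cell|exact: diam_set0].
apply: (@le_trans _ _ (\sum_(i <oo) diam_pow s (U i))%E).
  apply: ereal_inf_lbound; exists U => //; split; last exact: words_cover.
  by move=> i; apply: le_trans (Ud i) _; rewrite lee_fin.
rewrite (@sum_eventually0 _ _ (2 ^ M n)); first last.
- by move=> i; rewrite -size_words /U leqNgt => /negPf ->; rewrite diam_pow_set0.
- by move=> i; exact: diam_pow_ge0.
apply: (@le_trans _ _ (\sum_(0 <= i < 2 ^ M n) ((2 ^- n) `^ s)%:E)%E).
  by apply: lee_sum => i _; exact: diam_pow_le.
rewrite sumEFin sumr_const_nat subn0 lee_fin -[X in X <= _]mulr_natl.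
by rewrite natrX pow2n pow2Nn_powR -pow2D.
Qed.

Lemma digit_set_hausdorff_le s :
  (forall n0, exists2 n, (n0 <= n)%N & (M n)%:R <= s * n%:R) ->
  (hausdorff_dim X <= s%:E)%E.
Proof.
move=> hs.
have s0 : 0 <= s.
  have [n n1 hn] := hs 1%N.
  have n0 : 0 < n%:R :> R by rewrite ltr0n.
  by rewrite -(pmulr_lge0 _ n0); exact: le_trans hn.
apply: hausdorff_dim_le => // s' d ss' d0; apply/lee_addgt0Pr => e e0.
have [n1 h1] := pow2Nn_small d0.
have [n2 h2] := @pow2_small R (s' - s) e (ltac:(by rewrite subr_gt0)) e0.
have [n hn Mn] := hs (maxn n1 n2); rewrite geq_max in hn; case/andP: hn => hn1 hn2.
rewrite add0e; apply: le_trans (digit_set_premeasure_le _ (h1 _ hn1)) _.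
  exact: le_trans (ltW ss').
rewrite lee_fin; apply: le_trans (h2 _ hn2); apply: ler_pow2; lra.
Qed.

(** A list of words of level [n] that contains every word whose cell meets
    [U], when [U] has diameter at most [2 ^- n]: if the cell of [i] meets [U],
    all others do so only within distance 2 of [i]. *)
Definition window (U : set R) n : seq nat :=
  if pselect (exists kx : nat * R, U kx.2 /\ cell R n kx.1 kx.2) is left h then
    iota ((projT1 (cid h)).1 - 2) 5 else [::].

Lemma size_window U n : (size (window U n) <= 5)%N.
Proof. by rewrite /window; case: pselect => // h; rewrite size_iota. Qed.

Lemma window_set0 n : window set0 n = [::].
Proof. by rewrite /window; case: pselect => // h; case: (h) => kx []. Qed.

Lemma mem_window U n k x : (diam U <= (2 ^- n)%:E)%E -> U x -> cell R n k x -> k \in window U n.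
Proof.
move=> /diam_leP dU Ux cx; rewrite /window; case: pselect => [h|[]]; last by exists (k, x).
case: cid => -[i y] [Uy cy]; have /andP[y1 y2] := cy; case/andP: cx => x1 x2.
have p0 : 0 < 2 ^+ n :> R by rewrite exprn_gt0.
have := dU _ _ Ux Uy; rewrite -(ler_pM2r p0) mulVf ?gt_eqF // -{1}(gtr0_norm p0) -normrM mulrBl.
rewrite ler_norml => /andP[h1 h2].
rewrite mem_iota /=; rewrite /= in Uy cy y1 y2 h1 h2 *; apply/andP; split.
  rewrite leq_subLR -(ler_nat R) natrD; move: x2; rewrite -(natr1 k); lra.
apply: (@leq_trans (i + 3)%N); last by lia.
rewrite -(ltr_nat R) natrD; move: y2; rewrite -(natr1 i); lra.
Qed.

(** The mass distribution principle. In a cover with a small sum of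
    [diam_pow t], each set is replaced by the at most 5 admissible cells that
    it meets at the dyadic scale of its diameter. These have total mass below
    1, so some branch avoids all of them and its point is not covered. *)
Lemma digit_set_hausdorff_ge s n0 :
  (forall n, (n0 <= n)%N -> s * n%:R <= (M n)%:R) -> (s%:E <= hausdorff_dim X)%E.
Proof.
move=> hs; have [s0|s0] := leP s 0.
  by apply: le_trans (hausdorff_dim_ge0 _); rewrite lee_fin.
apply: hausdorff_dim_ge => t /andP[t0 ts].
(* A set of diameter [d] meets at most 5 words of level [L], where
   [2 ^- M L <= 2 `^ t * d `^ t] up to an error. A total of [d `^ t] below [c]
   thus yields the mass [5 * 2 `^ t * c = 1 / 4], and the errors add up to
   at most [5 / 20 = 1 / 4]. *)
pose c : R := (20 * 2 `^ t)^-1.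
have t20 : 0 < 2 `^ t :> R by rewrite powR_gt0.
have c0 : 0 < c by rewrite invr_gt0 mulr_gt0.
exists (2 ^- n0), c; split => //.
apply: le_ereal_inf_tmp => _ [U [Ud XU] <-]; rewrite leNgt; apply/negP => sumU.
have step j : exists n, (diam (U j) <= (2 ^- n)%:E)%E /\
   (U j !=set0 -> ((2 ^- M n)%:E <= (2 `^ t)%:E * diam_pow t (U j) + (20^-1 / (2 ^ j.+1)%:R)%:E)%E).
  have [U0|/set0P U0] := eqVneq (U j) set0.
    by exists 0%N; rewrite U0; split; [exact: diam_set0|case].
  have [d /andP[d0 dn0] Ujd] := diam_fin U0 (Ud j).
  (* A one-point set has every level as a scale: the error term pays for it. *)
  move: d0; rewrite le_eqVlt => /predU1P[d0|d0].
    have e0 : 0 < 20^-1 / (2 ^ j.+1)%:R :> R by rewrite divr_gt0 ?invr_gt0 // ltr0n expn_gt0.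
    have [n1 h1] := pow2_small s0 e0.
    exists (maxn n0 n1); split; first by rewrite Ujd -d0 lee_fin invr_ge0 exprn_ge0.
    move=> _; rewrite (diam_powE _ U0 Ujd) -EFinM -EFinD lee_fin.
    apply: le_trans (le_trans (h1 (maxn n0 n1) (leq_maxr _ _)) _); last first.
      by rewrite lerDr mulr_ge0 ?powR_ge0.
    by rewrite pow2Nn ler_pow2 // lerN2 hs // leq_maxl.
  have [n nn0 /andP[dn1 dn]] := @dyadic_scale R n0 d (ltac:(by rewrite d0)).
  exists n; split; first by rewrite Ujd lee_fin.
  move=> _; rewrite (diam_powE _ U0 Ujd) -EFinM -EFinD lee_fin ler_wpDr //.
  rewrite -powRM ?(ltW d0) //.
  apply: (@le_trans _ _ ((2 ^- n) `^ t)).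
    rewrite pow2Nn_powR pow2Nn ler_pow2 // lerN2; apply: le_trans (hs _ nn0).
    by rewrite ler_wpM2r // ltW.
  rewrite ge0_ler_powR ?nnegrE ?invr_ge0 ?exprn_ge0 ?mulr_ge0 ?(ltW d0) //.
  move: dn1; rewrite exprS invfM; lra.
have [L LP] := choice step.
have [|p bp pA] := @avoiding_branch R free L (fun j => window (U j) (L j)).
  pose g j : \bar R := ((5 * 2 `^ t)%:E * diam_pow t (U j))%E.
  have g0 j : (0 <= g j)%E by rewrite mule_ge0 ?diam_pow_ge0 // lee_fin mulr_ge0 // ltW.
  apply: (@le_lt_trans _ _ (\sum_(j <oo) (g j + (4^-1 / (2 ^ j.+1)%:R)%:E))%E).
    apply: lee_nneseries => j _; first by move=> _; rewrite lee_fin mulr_ge0 ?invr_ge0 ?exprn_ge0.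
    have [U0|/set0P U0] := eqVneq (U j) set0.
      by rewrite U0 window_set0 mul0r adde_ge0 // lee_fin divr_ge0.
    apply: (@le_trans _ _ (5%:E * (2 ^- M (L j))%:E)%E).
      by rewrite -EFinM lee_fin ler_wpM2r ?invr_ge0 ?exprn_ge0 // ler_nat size_window.
    apply: le_trans (lee_wpmul2l _ ((LP j).2 U0)) _; first by rewrite lee_fin.
    rewrite ge0_muleDr ?mule_ge0 ?diam_pow_ge0 ?lee_fin ?divr_ge0 ?powR_ge0 //.
    rewrite muleA -EFinM leeD2l // -EFinM lee_fin mulrA ler_wpM2r //.
    lra.
  apply: (le_lt_trans (epsilon_trick _ g0 _)) => //.
  rewrite /g nneseriesZl; last by move=> i _; exact: diam_pow_ge0.
  apply: (@le_lt_trans _ _ ((5 * 2 `^ t)%:E * c%:E + 4^-1%:E)%E).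
    by rewrite leeD2r // lee_wpmul2l ?(ltW sumU) // lee_fin mulr_ge0 // ltW.
  rewrite -EFinM -EFinD lte_fin /c.
  rewrite [X in X + _](_ : _ = 4^-1); first by lra.
  by field; rewrite gt_eqF.
have [x Xx xp] := branch_point R bp.
have [j _ Ux] := XU x Xx.
have := pA j; rewrite (mem_window _ Ux (xp (L j))) //.
exact: (LP j).1.
Qed.

End Hausdorff.

(** * Box and modified box dimensions of a digit set *)

Section LimitsAtRight.
Variable R : realType.
Implicit Types (f : R -> \bar R) (s : \bar R).

Lemma near_right0P (P : R -> Prop) :
  (\forall e \near 0^'+, P e) <-> exists2 d : R, 0 < d & forall e, 0 < e < d -> P e.
Proof.
split=> [[d /= d0 h]|[d d0 h]].
  exists d => // e /andP[e0 ed]; apply: h => //=.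
  by rewrite sub0r normrN gtr0_norm.
by near=> e; apply: h; apply/andP; split; near: e; [exact: nbhs_right_gt|exact: nbhs_right_lt].
Unshelve. all: by end_near.
Qed.

Lemma limf_einf_right_le f s :
  (forall d : R, 0 < d -> exists2 e, 0 < e < d & (f e <= s)%E) ->
  (limf_einf f 0^'+ <= s)%E.
Proof.
move=> h; rewrite limf_einfE; apply: ge_ereal_sup => _ [V /near_right0P[d d0 dV] <-].
have [e ed fe] := h d d0; apply: le_trans fe; apply: ereal_inf_lbound.
by exists e => //; exact: dV.
Qed.

Lemma limf_einf_right_ge f s :
  (exists2 d : R, 0 < d & forall e, 0 < e < d -> (s <= f e)%E) ->
  (s <= limf_einf f 0^'+)%E.
Proof.
move=> [d d0 h]; rewrite limf_einfE; apply: le_ereal_sup_tmp.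
exists (ereal_inf [set f x | x in [set e : R | 0 < e < d]]).
  by exists [set e : R | 0 < e < d] => //; apply/near_right0P; exists d.
by apply: le_ereal_inf_tmp => _ [e /h ? <-].
Qed.

Lemma limf_esup_right_ge f s :
  (forall d : R, 0 < d -> exists2 e, 0 < e < d & (s <= f e)%E) ->
  (s <= limf_esup f 0^'+)%E.
Proof.
move=> h; apply: le_ereal_inf_tmp => _ [V /near_right0P[d d0 dV] <-].
have [e ed fe] := h d d0; apply: le_trans fe _; apply: ereal_sup_ubound.
by exists e => //; exact: dV.
Qed.

Lemma limf_esup_right_le f s :
  (exists2 d : R, 0 < d & forall e, 0 < e < d -> (f e <= s)%E) ->
  (limf_esup f 0^'+ <= s)%E.
Proof.
move=> [d d0 h]; apply: ge_ereal_inf.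
exists (ereal_sup [set f x | x in [set e : R | 0 < e < d]]).
  by exists [set e : R | 0 < e < d] => //; apply/near_right0P; exists d.
by apply: ge_ereal_sup => _ [e /h ? <-].
Qed.

End LimitsAtRight.

Section Box.
Variables (R : realType) (free : nat -> bool).
Local Notation X := (digit_set R free).
Local Notation M := (nfree free).
Implicit Types (s e : R) (F G : set R).

Lemma covering_number_ge0 e F : (0 <= covering_number e F)%E.
Proof. by apply: le_ereal_inf_tmp => _ [n _ <-]; rewrite lee_fin. Qed.

Lemma covering_number_le n e : 2 ^- n <= e -> (covering_number e X <= (2 ^+ M n)%:E)%E.
Proof.
move=> ne; rewrite -natrX -size_words; apply: ereal_inf_lbound.
exists (size (words free n)) => //.
exists (fun i => cell R n (nth 0%N (words free n) i)); split.
  by move=> i; apply: le_trans (diam_cell R n _) _; rewrite lee_fin.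
move=> x /(@words_cover R free n)[i _]; case: ifP => // i_s cx.
by exists (Ordinal i_s).
Qed.

(** Two points at distance above [e] cannot lie in the same set of a cover. *)
Lemma covering_number_ge (I : eqType) e G (r : seq I) (x : I -> R) : uniq r ->
  (forall i, i \in r -> G (x i)) ->
  {in r &, forall i j, i != j -> e < `|x i - x j|} ->
  ((size r)%:R%:E <= covering_number e G)%E.
Proof.
move=> r_uniq xG x_sep; apply: le_ereal_inf_tmp => _ [n [U [Ud GU]] <-].
rewrite lee_fin ler_nat.
have step i : exists j : option 'I_n, i \in r -> if j is Some j' then U j' (x i) else False.
  have [ir|_] := boolP (i \in r); last by exists None.
  by have [j _ Uj] := GU _ (xG _ ir); exists (Some j).
have [f fP] := choice step.
have : uniq (map f r).
  rewrite map_inj_in_uniq // => i j ir jr fij; apply/eqP; apply: contraT => ij.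
  have := fP _ ir; have := fP _ jr; rewrite fij; case: (f j) => // k Uj Ui.
  by have /diam_leP/(_ _ _ Ui Uj) := Ud k; rewrite leNgt x_sep.
have sub : {subset map f r <= map Some (enum 'I_n)}.
  move=> _ /mapP[i ir ->]; have := fP _ ir; case: (f i) => // k _.
  by apply: map_f; rewrite mem_enum.
by move=> /uniq_leq_size /(_ sub); rewrite 2!size_map size_enum_ord.
Qed.

Lemma box_ratio_le n e : 2 ^- n <= e -> e < 1 ->
  (box_ratio X e <= ((M n)%:R * ln 2 / - ln e)%:E)%E.
Proof.
move=> ne e1; have e0 : 0 < e by apply: lt_le_trans ne; rewrite invr_gt0 exprn_gt0.
have le0 : 0 < - ln e by rewrite oppr_gt0 ln_lt0 // e0.
rewrite EFinM; apply: lee_wpmul2r; first by rewrite lee_fin invr_ge0 ltW.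
have p0 : 0 < 2 ^+ M n :> R by rewrite exprn_gt0.
have -> : ((M n)%:R * ln 2)%:E = lne (2 ^+ M n)%:E :> \bar R.
  by rewrite /= leNgt p0 /= lnXn // mulr_natl.
by rewrite lee_lne ?covering_number_le // in_itv /= leey andbT ?covering_number_ge0 // lee_fin ltW.
Qed.

Lemma box_ratio_ge e G k : 0 < e < 1 -> ((2 ^ k)%:R%:E <= covering_number e G)%E ->
  ((k%:R * ln 2 / - ln e)%:E <= box_ratio G e)%E.
Proof.
move=> /andP[e0 e1] kG.
have le0 : 0 < - ln e by rewrite oppr_gt0 ln_lt0 // e0.
rewrite EFinM; apply: lee_wpmul2r; first by rewrite lee_fin invr_ge0 ltW.
have p0 : 0 < 2 ^+ k :> R by rewrite exprn_gt0.
have -> : (k%:R * ln 2)%:E = lne (2 ^+ k)%:E :> \bar R.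
  by rewrite /= leNgt p0 /= lnXn // mulr_natl.
by rewrite natrX in kG; rewrite lee_lne // in_itv /= leey andbT ?covering_number_ge0 // lee_fin ltW.
Qed.

Lemma digit_set_lower_box_dim_le s : (forall n0, exists2 n, (n0 <= n)%N & (M n)%:R <= s * n%:R) ->
  (lower_box_dim X <= s%:E)%E.
Proof.
move=> hs; apply: limf_einf_right_le => d d0.
have d20 : 0 < d / 2 by rewrite divr_gt0.
have [n1 h1] := pow2Nn_small d20.
have [n] := hs (maxn n1 1); rewrite geq_max => /andP[nn1 n0] Mn.
exists (2 ^- n); first by rewrite pow2Nn_gt0 /=; have := h1 _ nn1; lra.
apply: le_trans (box_ratio_le (lexx _) (pow2Nn_lt1 _ n0)) _.
rewrite lee_fin ln_pow2Nn ler_pdivrMr ?mulr_gt0 ?ltr0n ?ln2_gt0 //.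
by rewrite mulrA ler_pM2r ?ln2_gt0.
Qed.

(** At a scale between [2 ^- n.+1] and [2 ^- n] the cells of level [n.+1] are
    used; the shift from [n] to [n.+1] is absorbed by [e]. *)
Lemma digit_set_upper_box_dim_le s n0 : (forall n, (n0 <= n)%N -> (M n)%:R <= s * n%:R) ->
  (upper_box_dim X <= s%:E)%E.
Proof.
move=> hs; apply/lee_addgt0Pr => e e0; apply: limf_esup_right_le.
have [n1 h1] := archi_nat_mul s e0.
pose N := maxn n0 (maxn n1 1).
exists (2 ^- N) => [|d /andP[d0 dN]]; first exact: pow2Nn_gt0.
have [n] := @dyadic_scale R N d (ltac:(by rewrite d0 ltW)).
rewrite !geq_max => /and3P[nn0 nn1 n_gt0] /andP[dn1 dn].
have d1 : d < 1 by apply: le_lt_trans dn (pow2Nn_lt1 _ n_gt0).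
apply: le_trans (box_ratio_le (ltW dn1) d1) _.
have lnd : n%:R * ln 2 <= - ln d by rewrite -ln_pow2Nn lerN2 ler_ln ?posrE ?pow2Nn_gt0.
have nR : 0 < n%:R :> R by rewrite ltr0n.
have lnd0 : 0 < - ln d by apply: lt_le_trans lnd; rewrite mulr_gt0 ?ln2_gt0.
rewrite lee_fin ler_pdivrMr //.
have Mn : (M n.+1)%:R <= (s + e) * n%:R.
  apply: le_trans (hs _ (leqW nn0)) _; rewrite -natr1 mulrDr mulr1 mulrDl lerD2l; exact: h1.
apply: (@le_trans _ _ ((s + e) * n%:R * ln 2)); first by rewrite ler_wpM2r // ltW ?ln2_gt0.
rewrite -mulrA ler_wpM2l // -(pmulr_lge0 _ nR); exact: le_trans Mn.
Qed.

Variables (G : set R) (n0 k0 : nat).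
Hypotheses (k0w : k0 \in words free n0)
  (hG : dense_below free G n0 k0).

Lemma size_desc_expn m : size (desc free n0 k0 m) = (2 ^ (M (n0 + m) - M n0))%N.
Proof.
apply/eqP; rewrite -(eqn_pmul2r (m := 2 ^ M n0)) ?expn_gt0 // size_desc -expnD subnK //.
exact: nfree_mono (leq_addr _ _).
Qed.

Lemma covering_number_dense_ge n e : (n0 <= n)%N -> e <= 2 ^- n.+1 ->
  ((2 ^ (M n - M n0))%:R%:E <= covering_number e G)%E.
Proof.
move=> n0n en; have [x [xG x_sep]] := separated_points k0w hG (n - n0).
move: xG x_sep (size_desc_expn (n - n0)); rewrite subnKC // => xG x_sep <-.
apply: (covering_number_ge (desc_uniq _ _ _ _) xG) => i j ir jr ij.
exact: le_lt_trans en (x_sep _ _ ir jr ij).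
Qed.

(** The constant [M n0] and the shift of two levels between the scale and
    the separated family disappear in the limit. *)
Lemma dense_lower_box_dim_ge s n1 : (forall n, (n1 <= n)%N -> s * n%:R <= (M n)%:R) ->
  (s%:E <= lower_box_dim G)%E.
Proof.
move=> hs; apply/lee_subgt0Pr => e e0; apply: limf_einf_right_ge.
have [n2 h2] := archi_nat_mul (2 * s + (M n0)%:R) e0.
pose N := maxn n0 (maxn n1 n2).
exists (2 ^- N.+1) => [|d /andP[d0 dN]]; first exact: pow2Nn_gt0.
have [[|n] //] := @dyadic_scale R N.+1 d (ltac:(by rewrite d0 ltW)).
rewrite ltnS !geq_max => /and3P[nn0 nn1 nn2] /andP[dn1 dn].
have d1 : d < 1 by apply: le_lt_trans dn (pow2Nn_lt1 _ _).
apply: le_trans (box_ratio_ge _ (covering_number_dense_ge nn0 dn)); last by rewrite d0.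
have lnd : - ln d <= n.+2%:R * ln 2 by rewrite -ln_pow2Nn lerN2 ler_ln ?posrE ?pow2Nn_gt0 // ltW.
have lnd0 : 0 < - ln d by rewrite oppr_gt0 ln_lt0 // d0.
rewrite -EFinB lee_fin ler_pdivlMr //.
have [se|se] := leP (s - e) 0.
  apply: (@le_trans _ _ 0); first by rewrite mulr_le0_ge0 // ltW.
  by rewrite mulr_ge0 // ltW // ln2_gt0.
apply: le_trans (ler_wpM2l (ltW se) lnd) _; rewrite mulrA ler_wpM2r ?(ltW (ln2_gt0 _)) //.
rewrite natrB ?nfree_mono //; have := hs _ nn1; have := h2 _ nn2.
rewrite -(natr1 n.+1) -(natr1 n); lra.
Qed.

Lemma dense_upper_box_dim_ge s : (forall n1, exists2 n, (n1 <= n)%N & s * n%:R <= (M n)%:R) ->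
  (s%:E <= upper_box_dim G)%E.
Proof.
move=> hs; apply/lee_subgt0Pr => e e0; apply: limf_esup_right_ge => d d0.
have d20 : 0 < d / 2 by rewrite divr_gt0.
have [n1 h1] := pow2Nn_small d20.
have [n2 h2] := archi_nat_mul (s + (M n0)%:R) e0.
have [n] := hs (maxn n0 (maxn n1 n2)); rewrite !geq_max => /and3P[nn0 nn1 nn2] Mn.
exists (2 ^- n.+1); first by rewrite pow2Nn_gt0 /=; have := h1 _ (leqW nn1); lra.
apply: le_trans (box_ratio_ge _ (covering_number_dense_ge nn0 (lexx _))); last first.
  by rewrite pow2Nn_gt0 pow2Nn_lt1.
rewrite -EFinB lee_fin ln_pow2Nn ler_pdivlMr ?mulr_gt0 ?ltr0n ?ln2_gt0 //.
rewrite mulrA ler_wpM2r ?(ltW (ln2_gt0 _)) //.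
rewrite natrB ?nfree_mono //; have := h2 _ nn2.
rewrite -(natr1 n); lra.
Qed.

End Box.

Section ModifiedBox.
Variables (R : realType) (free : nat -> bool).
Local Notation X := (digit_set R free).
Local Notation M := (nfree free).

(** The constant cover shows that a modified box dimension is at most the box dimension. *)
Lemma digit_set_bounded_cover : bounded_covers X (fun=> X).
Proof.
have [|x0 Xx0 _] := @branch_point R free (fun=> 0%N).
  move=> n; split => //; elim: n => [|n IH]; first by rewrite words0.
  by rewrite mem_wordsS IH.
split; last by move=> x Xx; exists 0%N.
move=> _; split; first by exists x0.
apply/ex_bound; first exact: globally_properfilter Xx0.
exists 1 => x /digit_set_branch[p bp /(_ 0%N)].
have := (bp 0).1; rewrite words0 => /eqP ->.
by rewrite /cell /= mulr1 ler_norml => /andP[x_ge0 ->]; rewrite andbT; lra.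
Qed.

Lemma digit_set_lower_mbox_dim_le : (lower_mbox_dim X <= lower_box_dim X)%E.
Proof.
apply: ge_ereal_inf; eexists; first by exists (fun=> X); first exact: digit_set_bounded_cover.
by apply: ge_ereal_sup => _ [i _ <-].
Qed.

Lemma digit_set_upper_mbox_dim_le : (upper_mbox_dim X <= upper_box_dim X)%E.
Proof.
apply: ge_ereal_inf; eexists; first by exists (fun=> X); first exact: digit_set_bounded_cover.
by apply: ge_ereal_sup => _ [i _ <-].
Qed.

Lemma digit_set_lower_mbox_dim_ge (s : R) n1 : (forall n, (n1 <= n)%N -> s * n%:R <= (M n)%:R) ->
  (s%:E <= lower_mbox_dim X)%E.
Proof.
move=> hs; apply: le_ereal_inf_tmp => _ [G [_ XG] <-].
have [i [n [k [kw hG]]]] := cover_dense_below XG.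
apply: le_trans (dense_lower_box_dim_ge kw hG hs) _.
by apply: ereal_sup_ubound; exists i.
Qed.

Lemma digit_set_upper_mbox_dim_ge (s : R) : (forall n1, exists2 n, (n1 <= n)%N & s * n%:R <= (M n)%:R) ->
  (s%:E <= upper_mbox_dim X)%E.
Proof.
move=> hs; apply: le_ereal_inf_tmp => _ [G [_ XG] <-].
have [i [n [k [kw hG]]]] := cover_dense_below XG.
apply: le_trans (dense_upper_box_dim_ge kw hG hs) _.
by apply: ereal_sup_ubound; exists i.
Qed.

End ModifiedBox.

(** * Packing dimension of a digit set *)

Section PackingAux.
Variable R : realType.
Implicit Types (s d : R) (F : set R).

(** The sum over packings is nondecreasing in [d], so the limit at 0 is an infimum. *)
Lemma packing_premeasureE s F :
  packing_premeasure s F = ereal_inf [set packing_presum s d F | d in [set d : R | 0 < d]].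
Proof.
rewrite /packing_premeasure.
have := @nondecreasing_at_right_cvge R (fun d => packing_presum s d F) 0 +oo%O isT.
have -> : [set` Interval (BRight 0) +oo%O] = [set d : R | 0 < d].
  by apply/seteqP; split=> x; rewrite /= in_itv /= andbT.
move=> h; apply/cvg_lim => //; apply: h => a b _ _ ab.
apply: ereal_sup_le => _ [[[J c] r] [Jcr disj] <-]; exists (J, c, r) => //; split=> // i Ji.
by have [Fc /andP[r0 ra]] := Jcr i Ji; rewrite r0 (le_trans ra).
Qed.

Lemma packing_presum_ge0 s d F : (0 <= packing_presum s d F)%E.
Proof.
apply: ereal_sup_ubound; exists (set0, fun=> 0, fun=> 0); last exact: esum_set0.
by split=> [i []|i j []].
Qed.

Lemma packing_premeasure_ge0 s F : (0 <= packing_premeasure s F)%E.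
Proof.
rewrite packing_premeasureE; apply: le_ereal_inf_tmp => _ [d _ <-]; exact: packing_presum_ge0.
Qed.

Lemma packing_premeasure_set0 s : packing_premeasure s (@set0 R) = 0%E.
Proof.
apply/eqP; rewrite eq_le packing_premeasure_ge0 andbT packing_premeasureE.
apply: ge_ereal_inf; exists (packing_presum s 1 set0); first by exists 1 => //=.
apply: ge_ereal_sup => _ [[[J c] r] [Jcr _] <-].
suff -> : J = set0 by rewrite esum_set0.
by apply/seteqP; split=> // i /Jcr [].
Qed.

(** A lower bound for one piece of each countable cover is enough, as the
    packing measure sums the premeasures of the pieces. *)
Lemma packing_dim_ge F s :
  (forall s' (G : nat -> set R), 0 <= s' < s -> F `<=` \bigcup_i G i ->
     exists i, (1 <= packing_premeasure s' (G i))%E) -> (s%:E <= packing_dim F)%E.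
Proof.
move=> h; apply: le_ereal_inf_tmp => _ [s' [s'0 Ps'] <-]; rewrite lee_fin leNgt.
apply/negP => ss'; have : (1 <= packing_measure s' F)%E.
  apply: le_ereal_inf_tmp => _ [G FG <-].
  have [|i Gi] := h s' G _ FG; first by rewrite s'0.
  have := @nneseries_lim_ge R (fun i => packing_premeasure s' (G i)) xpredT 0 i.+1
    (fun _ _ _ => packing_premeasure_ge0 _ _).
  apply: le_trans; apply: le_trans Gi _; rewrite big_nat_recr //= leeDr //.
  by apply: sume_ge0 => j _; exact: packing_premeasure_ge0.
by rewrite Ps' lee_fin ler10.
Qed.

(** The packing measure is at most the premeasure, through the cover by
    [F] itself and empty sets. *)
Lemma packing_dim_le F s : 0 <= s ->
  (forall s' e : R, s < s' -> 0 < e ->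
     exists2 d, 0 < d & (packing_presum s' d F <= e%:E)%E) ->
  (packing_dim F <= s%:E)%E.
Proof.
move=> s0 h; apply/lee_addgt0Pr => e e0; apply: ereal_inf_lbound.
exists (s + e) => //; split; first by rewrite addr_ge0 // ltW.
have P0 : packing_premeasure (s + e) F = 0%E.
  apply/eqP; rewrite eq_le packing_premeasure_ge0 andbT packing_premeasureE.
  apply/lee_addgt0Pr => t t0; rewrite add0e.
  have [|d d0 hd] := h (s + e) t _ t0; first by rewrite ltrDl.
  by apply: ge_ereal_inf; exists (packing_presum (s + e) d F) => //; exists d.
apply/eqP; rewrite eq_le; apply/andP; split; last first.
  apply: le_ereal_inf_tmp => _ [G _ <-]; apply: nneseries_ge0 => i _ _.
  exact: packing_premeasure_ge0.
apply: ereal_inf_lbound; exists (fun i => if i is 0 then F else set0).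
  by move=> x Fx; exists 0%N.
by rewrite eseries0 // => -[|i] _ _ //=; exact: packing_premeasure_set0.
Qed.

Lemma closed_ballP (c r y : R) : 0 < r -> closed_ball c r y <-> `|c - y| <= r.
Proof. by move=> r0; rewrite closed_ballE. Qed.

Lemma diam_closed_ball (c r : R) : 0 < r -> diam (closed_ball c r) = (2 * r)%:E.
Proof.
move=> r0; apply/eqP; rewrite eq_le; apply/andP; split.
  apply/diam_leP => x y /(closed_ballP _ _ r0) cx /(closed_ballP _ _ r0) cy.
  rewrite (_ : x - y = (c - y) - (c - x)); last by ring.
  by apply: le_trans (ler_normB _ _) _; rewrite mulr2n mulrDl mul1r lerD.
apply: ereal_sup_ubound; exists (c + r).
  by apply/closed_ballP => //; rewrite opprD addNKr normrN gtr0_norm.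
exists (c - r); first by apply/closed_ballP => //; rewrite subKr gtr0_norm.
rewrite (_ : c + r - (c - r) = 2 * r); last by ring.
by rewrite gtr0_norm // mulr_gt0.
Qed.

Lemma diam_pow_closed_ball s (c r : R) : 0 < r ->
  diam_pow s (closed_ball c r) = ((2 * r) `^ s)%:E.
Proof.
move=> r0; apply: diam_powE; last exact: diam_closed_ball.
by exists c; apply/closed_ballP => //; rewrite subrr normr0 ltW.
Qed.

Lemma esum_le (J : set nat) (f : nat -> \bar R) (b : \bar R) :
  (forall t : seq nat, uniq t -> (forall i, i \in t -> J i) -> (\sum_(i <- t) f i <= b)%E) ->
  (\esum_(i in J) f i <= b)%E.
Proof.
move=> h; apply: ge_ereal_sup => _ [A [finA AJ] <-].
have [t At] := (finite_seqP A).1 finA.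
have -> : A = [set` undup t] by rewrite At; apply/seteqP; split=> i /=; rewrite mem_undup.
rewrite -fsbig_seq ?undup_uniq //; apply: h; first exact: undup_uniq.
by move=> i; rewrite mem_undup => it; apply: AJ; rewrite At.
Qed.

Lemma geometric_le (q : R) K : 0 <= q < 1 -> \sum_(j < K) q ^+ j <= (1 - q)^-1.
Proof.
move=> /andP[q0 q1]; have q10 : 0 < 1 - q by rewrite subr_gt0.
rewrite -(ler_pM2l q10) divff ?gt_eqF // -opprB mulNr -subrX1 opprB.
by rewrite gerBl exprn_ge0.
Qed.

End PackingAux.

Section Packing.
Variables (R : realType) (free : nat -> bool).
Local Notation X := (digit_set R free).
Local Notation M := (nfree free).
Implicit Types (s d e : R) (F G : set R).

(** The separated points are centres of disjoint balls of radius
    [2 ^- n.+2], because their mutual distances exceed twice this radius. *)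
Lemma packing_presum_dense_ge G n0 k0 n s d : k0 \in words free n0 ->
  dense_below free G n0 k0 ->
  (n0 <= n)%N -> 2 ^- n.+2 <= d ->
  ((2 `^ ((M n)%:R - (M n0)%:R - s * n.+1%:R))%:E <= packing_presum s d G)%E.
Proof.
move=> k0w hG n0n nd; have [x [xG x_sep]] := separated_points k0w hG (n - n0).
have := size_desc_expn free n0 k0 (n - n0); rewrite subnKC // => sz.
rewrite subnKC // in x_sep.
set t := desc free n0 k0 (n - n0) in xG x_sep sz.
have r0 : 0 < 2 ^- n.+2 :> R by exact: pow2Nn_gt0.
have r2 : 2 * 2 ^- n.+2 = 2 ^- n.+1 :> R by rewrite exprS invfM mulrA divff ?mul1r.
apply: le_ereal_sup_tmp; exists (\esum_(i in [set` t]) diam_pow s (closed_ball (x i) (2 ^- n.+2)))%E.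
  exists ([set` t], x, fun=> 2 ^- n.+2) => //; split.
    by move=> i /= it; split; [exact: xG|rewrite r0].
  move=> i j /= it jt [y [/(closed_ballP _ _ r0) yi /(closed_ballP _ _ r0) yj]].
  apply/eqP; apply: contraT => ij; have := x_sep i j it jt ij.
  rewrite -r2 ltNge (_ : x i - x j = (x i - y) - (x j - y)); last by ring.
  by rewrite (le_trans (ler_normB _ _)) // mulr2n mulrDl mul1r lerD.
apply: esum_ge; exists [set` t]; first by split=> //; exact: finite_seq.
rewrite -fsbig_seq ?desc_uniq //.
under eq_bigr do rewrite diam_pow_closed_ball // r2 pow2Nn_powR.
rewrite sumEFin big_const_seq count_predT sz iter_addr_0 lee_fin -[leRHS]mulr_natl natrX.
by rewrite pow2n natrB ?nfree_mono // -pow2D.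
Qed.

Lemma digit_set_packing_ge s : (forall n1, exists2 n, (n1 <= n)%N & s * n%:R <= (M n)%:R) ->
  (s%:E <= packing_dim X)%E.
Proof.
move=> hs; apply: packing_dim_ge => s' G /andP[s'0 s's] XG.
have [i [n0 [k0 [kw hG]]]] := cover_dense_below XG.
exists i; rewrite packing_premeasureE; apply: le_ereal_inf_tmp => _ [d /= d0 <-].
have [n1 h1] := pow2Nn_small d0.
have [n2 h2] := @archi_nat_mul R (s - s') ((M n0)%:R + s') (ltac:(by rewrite subr_gt0)).
have [n] := hs (maxn n0 (maxn n1 n2)); rewrite !geq_max => /and3P[nn0 nn1 nn2] Mn.
apply: le_trans (packing_presum_dense_ge _ kw hG nn0 (h1 _ _)); last by lia.
rewrite lee_fin -{1}(powRr0 2) ler_pow2 //; have := h2 _ nn2.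
rewrite -(natr1 n); lra.
Qed.

(** The balls of a packing are grouped by the dyadic scale of their radii.
    Two centres in a common cell of level [j.+1] are at distance at most
    [2 ^- j.+1], less than any radius of scale [j], so that there are at most
    [2 ^ M j.+1] balls of this scale. The resulting bounds form a convergent
    geometric series in [j], whose tail is small. *)
Lemma digit_set_packing_le s n0 : (forall n, (n0 <= n)%N -> (M n)%:R <= s * n%:R) ->
  (packing_dim X <= s%:E)%E.
Proof.
move=> hs.
have s0 : 0 <= s.
  have n1 : 0 < n0.+1%:R :> R by rewrite ltr0n.
  by rewrite -(pmulr_lge0 _ n1); exact: le_trans (hs _ (leqnSn _)).
apply: packing_dim_le => // s' e ss' e0.
(* Balls of scale [j >= N] contribute at most a constant times
   [2 `^ (- 2 * h * j) <= 2 `^ (- h * N) * q ^+ j]: half of the exponent makes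
   the series converge, the other half makes its sum small. *)
pose h := (s' - s) / 2; have h0 : 0 < h by rewrite divr_gt0 ?subr_gt0.
pose q : R := 2 `^ (- h).
have q01 : 0 <= q < 1.
  have q1 : q <= 1 by rewrite -[leRHS](powRr0 2) ler_pow2 // oppr_le0 ltW.
  rewrite powR_ge0 lt_neqAle q1 andbT powR_eq1 oppr_eq0 (gt_eqF h0) orbF.
  by rewrite pnatr_eq1 ltrn0.
have C0 : 0 < 2 `^ (s + s') / (1 - q).
  by rewrite divr_gt0 ?powR_gt0 // subr_gt0; case/andP: q01.
have [n1 h1] := @pow2_small R h (e / (2 `^ (s + s') / (1 - q))) h0 (divr_gt0 e0 C0).
pose N := maxn n0 n1.
exists (2 ^- N); first exact: pow2Nn_gt0.
apply: ge_ereal_sup => _ [[[J c] r] [Jcr disj] <-].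
apply: esum_le => t t_uniq tJ.
have scale i : exists n, i \in t -> (N <= n)%N /\ 2 ^- n.+1 < r i <= 2 ^- n.
  have [it|_] := boolP (i \in t); last by exists 0%N.
  have [Xc rN] := Jcr _ (tJ _ it).
  by have [n Nn rn] := dyadic_scale rN; exists n.
have [l lP] := choice scale.
have word i : exists k, i \in t -> k \in words free (l i).+1 /\ cell R (l i).+1 k (c i).
  have [it|_] := boolP (i \in t); last by exists 0%N.
  have [Xc rN] := Jcr _ (tJ _ it).
  by have [k kw ck] := digit_set_cell (l i).+1 Xc; exists k.
have [w wP] := choice word.
have inj i j : i \in t -> j \in t -> l i = l j -> w i = w j -> i = j.
  move=> it jt lij wij; have [_ ci] := wP _ it; have [_ cj] := wP _ jt.
  have [_ /andP[ri _]] := lP _ it; have [_ /andP[ri0 _]] := Jcr _ (tJ _ it).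
  have [_ /andP[rj0 _]] := Jcr _ (tJ _ jt).
  apply: disj; [exact: tJ|exact: tJ|exists (c j); split].
    apply/closed_ballP => //; apply: le_trans (ltW ri).
    by rewrite -lij -wij in cj; exact: cell_close ci cj.
  by apply/closed_ballP => //; rewrite subrr normr0 ltW.
pose g (n : nat) : R := (2 * 2 ^- n) `^ s'.
have s'0 : 0 <= s' by exact: le_trans (ltW ss').
apply: (@le_trans _ _ (\sum_(i <- t) (g (l i))%:E)%E).
  rewrite big_seq [leRHS]big_seq; apply: lee_sum => i it.
  have [_ /andP[ri0 _]] := Jcr _ (tJ _ it); have [_ /andP[_ rl]] := lP _ it.
  rewrite diam_pow_closed_ball // lee_fin ge0_ler_powR ?nnegrE ?mulr_ge0 ?(ltW ri0) //.
  by rewrite ler_pM2l.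
rewrite sumEFin lee_fin.
pose K := \max_(i <- t) l i.
have lK i : i \in t -> (l i < K.+1)%N by move=> it; rewrite ltnS; exact: leq_bigmax_seq.
rewrite (partition_big (fun i => inord (l i) : 'I_K.+1) xpredT) //=.
have inner (j : 'I_K.+1) : \sum_(i <- t | inord (l i) == j) g (l i) <=
    2 `^ (s + s') * 2 `^ (- (h * N%:R)) * q ^+ j.
  rewrite big_seq_cond.
  rewrite (eq_bigr (fun=> g j)); last first.
    by move=> i /andP[it /eqP <-]; rewrite inordK // lK.
  rewrite -big_seq_cond -big_filter; set t' := seq.filter _ t.
  have t't i : i \in t' -> i \in t /\ l i = j.
    by rewrite mem_filter => /andP[/eqP <- it]; rewrite inordK // lK.
  have [Nj|jN] := leqP N j; last first.
    case: t' t't => [_|i t'' /(_ i (mem_head _ _))[it li]].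
      by rewrite big_nil !mulr_ge0 ?powR_ge0 ?exprn_ge0 //; case/andP: q01.
    by have [] := lP _ it; rewrite li leqNgt jN.
  have szt' : (size t' <= 2 ^ M j.+1)%N.
    rewrite -size_words -(size_map w t'); apply: uniq_leq_size.
      rewrite map_inj_in_uniq ?filter_uniq // => i i' /t't[it li] /t't[i't li'].
      by apply: inj => //; rewrite li li'.
    by move=> _ /mapP[i /t't[it <-] ->]; case: (wP _ it).
  rewrite big_const_seq count_predT iter_addr_0 -[leLHS]mulr_natl.
  apply: (@le_trans _ _ (2 ^+ M j.+1 * g j)).
    by rewrite ler_wpM2r ?powR_ge0 // -natrX ler_nat.
  rewrite /g powRM ?(ltW (pow2Nn_gt0 _ _)) // pow2Nn_powR pow2n -!pow2D.
  rewrite /q -powR_mulrn ?powR_ge0 // -powRrM -!pow2D ler_pow2 //.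
  have /hs := leqW (leq_trans (leq_maxl n0 n1) Nj).
  have : h * N%:R <= h * j%:R by rewrite ler_pM2l // ler_nat.
  rewrite -(natr1 j) {1 2}/h /h; lra.
apply: le_trans (ler_sum _ (fun j _ => inner j)) _.
rewrite -mulr_sumr.
apply: (@le_trans _ _ (2 `^ (s + s') * 2 `^ (- (h * N%:R)) * (1 - q)^-1)).
  by rewrite ler_wpM2l ?mulr_ge0 ?powR_ge0 // geometric_le.
rewrite mulrAC mulrC -ler_pdivlMr //; apply: h1; exact: leq_maxr.
Qed.

End Packing.

(** * Digits that are free in consecutive blocks *)

Section Gaps.
Variables (R : realType) (free : nat -> bool).
Local Notation M := (nfree free).

Lemma nfree_gap p q : (p <= q)%N -> (forall n, (p < n <= q)%N -> ~~ free n) -> M q = M p.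
Proof.
move=> /subnKC <-; elim: (q - p)%N => [|d IH] h; first by rewrite addn0.
rewrite addnS nfreeS IH => [|n /andP[pn nd]]; last by apply: h; lia.
by rewrite (negPf (h _ _)) ?addn0; lia.
Qed.

Lemma nfree_run p q : (p <= q)%N -> (forall n, (p < n <= q)%N -> free n) ->
  M q = (M p + (q - p))%N.
Proof.
move=> pq; rewrite -{1 2}(subnKC pq); elim: (q - p)%N => [|d IH] h; first by rewrite !addn0.
rewrite addnS nfreeS IH => [|n /andP[pn nd]]; last by apply: h; lia.
by rewrite h /=; lia.
Qed.

Variables a b : nat -> nat.
Hypotheses (a1 : a 1%N = 0%N) (ab : forall i, (0 < i)%N -> (a i <= b i)%N)
  (ba : forall i, (0 < i)%N -> (b i < a i.+1)%N).
Hypothesis freeP : forall n, reflect (exists2 i, (0 < i)%N & (b i < n <= a i.+1)%N) (~~ free n).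

Lemma a_ltS i : (0 < i)%N -> (a i < a i.+1)%N.
Proof. by move=> i0; apply: leq_ltn_trans (ab i0) (ba i0). Qed.

Lemma a_le i j : (0 < i)%N -> (i <= j)%N -> (a i <= a j)%N.
Proof.
move=> i0 /subnKC <-; elim: (j - i)%N => [|d IH]; first by rewrite addn0.
by rewrite addnS; apply: leq_trans IH (ltnW (a_ltS _)); rewrite addn_gt0 i0.
Qed.

Lemma b_le i j : (0 < i)%N -> (i <= j)%N -> (b i <= b j)%N.
Proof.
move=> i0; rewrite leq_eqVlt => /predU1P[-> //|ij].
apply: leq_trans (ltnW (ba i0)) _; apply: leq_trans (a_le _ ij) (ab _) => //.
exact: leq_trans ij.
Qed.

Lemma a_ge i : (i <= a i.+1)%N.
Proof. by elim: i => // i IH; apply: leq_ltn_trans IH (a_ltS _). Qed.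

Lemma nfree_to_b k n : (0 < k)%N -> (a k <= n <= b k)%N -> M n = (M (a k) + (n - a k))%N.
Proof.
move=> k0 /andP[kn nk]; apply: nfree_run => // m /andP[km mn].
apply: contraT => /freeP[i i0 /andP[bm ma]].
have [ik|ki] := ltnP i k.
  by have := a_le (ltn0Sn i) ik; lia.
by have := b_le k0 ki; lia.
Qed.

Lemma nfree_from_b k n : (0 < k)%N -> (b k <= n <= a k.+1)%N -> M n = M (b k).
Proof.
move=> k0 /andP[kn nk]; apply: nfree_gap => // m /andP[km mn].
by apply/freeP; exists k => //; rewrite km (leq_trans mn).
Qed.

Lemma block_of n : (0 < n)%N -> exists2 k, (0 < k)%N & (a k < n <= a k.+1)%N.
Proof.
move=> n0; have ex : exists k, (n <= a k.+1)%N by exists n; exact: a_ge.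
case: (ex_minnP ex) => -[|k] nk kmin; first by move: nk; rewrite a1; lia.
exists k.+1; rewrite // nk andbT ltnNge; apply/negP => /kmin; lia.
Qed.

(** The intervals from [a k] to [a k.+1] are the periods of the pattern: a
    block of free positions up to [b k], then a gap. *)
Lemma late_block_of K n : (0 < K)%N -> (a K.+1 < n)%N ->
  exists2 k, (K < k)%N & (a k < n <= a k.+1)%N.
Proof.
move=> K0 Kn; have [|k k0 /andP[kn nk]] := @block_of n; first by lia.
exists k; last by rewrite kn.
by rewrite ltnNge; apply/negP => kK; have := @a_le k.+1 K.+1 isT kK; lia.
Qed.

(** Inside a block, the counting function grows with slope 1, at least [s],
    from the end of the previous gap; inside a gap it is constant, so the
    inequality at the end of the gap is the strongest. *)
Lemma nfree_ge_of_gap_ends (s : R) K :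
  (forall k, (K <= k)%N -> s * (a k.+1)%:R <= (M (a k.+1))%:R) ->
  exists n0, forall n, (n0 <= n)%N -> s * n%:R <= (M n)%:R.
Proof.
move=> hs; exists (a K.+2).+1 => n Kn.
have [s0|s0] := leP s 0; first by apply: (@le_trans _ _ 0); rewrite ?ler0n // mulr_le0_ge0.
have [k Kk /andP[kn nk]] := late_block_of (ltn0Sn K) Kn.
have k0 : (0 < k)%N by lia.
have s1 : s <= 1.
  have aK : 0 < (a K.+2)%:R :> R by rewrite ltr0n; apply: leq_trans (a_ge _).
  rewrite -(ler_pM2r aK) mul1r (le_trans (hs K.+1 _)) // ler_nat; exact: nfree_leq.
have [nb|bn] := leqP n (b k); last first.
  rewrite (@nfree_from_b k) ?(ltnW bn) // -(@nfree_from_b k (a k.+1)) ?leqnn ?(ltnW (ba k0)) //.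
  by apply: le_trans (hs k _); [rewrite ler_pM2l // ler_nat|lia].
rewrite (@nfree_to_b k) ?(ltnW kn) // natrD natrB ?(ltnW kn) //.
have := hs k.-1; rewrite (prednK k0) => /(_ ltac:(lia)) hk.
have d0 : 0 <= n%:R - (a k)%:R :> R by rewrite subr_ge0 ler_nat ltnW.
have : s * (n%:R - (a k)%:R) <= n%:R - (a k)%:R by rewrite ler_piMl.
lra.
Qed.

(** The mirror image of the previous argument: the inequality at [b k]
    propagates forwards through the gap, where the function is constant, and
    backwards through the block, where its slope 1 is at least [s] unless the
    claim is trivial. *)
Lemma nfree_le_of_run_ends (s : R) K :
  (forall k, (K <= k)%N -> (M (b k))%:R <= s * (b k)%:R) ->
  exists n0, forall n, (n0 <= n)%N -> (M n)%:R <= s * n%:R.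
Proof.
move=> hs; exists (a K.+2).+1 => n Kn.
have [k Kk /andP[kn nk]] := late_block_of (ltn0Sn K) Kn.
have k0 : (0 < k)%N by lia.
have bk0 : 0 < (b k)%:R :> R.
  rewrite ltr0n; apply: leq_trans (ab k0); rewrite -(prednK k0).
  by apply: leq_trans (a_ge _); lia.
have hk := hs k (ltac:(lia)).
have s0 : 0 <= s by rewrite -(pmulr_lge0 _ bk0); exact: le_trans hk.
have [nb|bn] := leqP n (b k); last first.
  rewrite (@nfree_from_b k) ?(ltnW bn) //; apply: (le_trans hk).
  by rewrite ler_wpM2l // ler_nat ltnW.
have [s1|s1] := leP 1 s.
  by apply: (@le_trans _ _ n%:R); [rewrite ler_nat nfree_leq|rewrite ler_peMl].
have Mn : (M n + (b k - n) = M (b k))%N.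
  have := @nfree_to_b k n k0; have := @nfree_to_b k (b k) k0.
  by rewrite leqnn ab // (ltnW kn) nb => /(_ isT) -> /(_ isT) ->; lia.
have {}Mn : (M n)%:R + ((b k)%:R - n%:R) = (M (b k))%:R :> R.
  by rewrite -natrB // -natrD Mn.
have : s * ((b k)%:R - n%:R) <= (b k)%:R - n%:R.
  by rewrite ler_piMl ?(ltW s1) // subr_ge0 ler_nat.
lra.
Qed.

Lemma nfree_block_sum k : (0 < k)%N -> M (b k) = (\sum_(1 <= i < k.+1) (b i - a i))%N.
Proof.
case: k => // k _; elim: k => [|k IH].
  by rewrite big_nat1 (@nfree_to_b 1) ?leqnn ?andbT ?ab // a1 nfree0.
rewrite big_nat_recr //= -IH (@nfree_to_b k.+2) ?leqnn ?andbT ?ab //.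
by rewrite (@nfree_from_b k.+1 (a k.+2)) // leqnn andbT ltnW ?ba.
Qed.

End Gaps.

(** * Lower and upper limits along the ends of gaps and blocks *)

Section LimitsOfSequences.
Variable R : realType.
Implicit Types (u : nat -> \bar R) (x y : \bar R).

Lemma lee_of_lt_reals x y : (forall s : R, (s%:E < y)%E -> (s%:E <= x)%E) -> (y <= x)%E.
Proof.
case: y => [r| |] h; last by rewrite leNye.
  apply/lee_subgt0Pr => e e0; rewrite -EFinB; apply: h.
  by rewrite lte_fin ltrBlDr ltrDl.
have -> : x = +oo%E by apply/eqyP => s _; apply: h; rewrite ltry.
by [].
Qed.

Lemma lee_of_gt_reals x y : (forall s : R, (y < s%:E)%E -> (x <= s%:E)%E) -> (x <= y)%E.
Proof.
move=> h; rewrite -leeN2; apply: lee_of_lt_reals => s hs.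
by rewrite leeNr -EFinN; apply: h; rewrite EFinN lteNr.
Qed.

Lemma limn_einfE u : limn_einf u = ereal_sup [set ereal_inf (u @` V) | V in \oo].
Proof. exact: limf_einfE. Qed.

Lemma lt_limn_einf u x : (x < limn_einf u)%E -> exists K, forall k, (K <= k)%N -> (x < u k)%E.
Proof.
rewrite limn_einfE => /ereal_sup_gt[_ [V [K _ KV] <-] xV]; exists K => k Kk.
by apply: lt_le_trans xV _; apply: ereal_inf_lbound; exists k => //; exact: KV.
Qed.

Lemma limn_einf_lt u x : (limn_einf u < x)%E -> forall K, exists2 k, (K <= k)%N & (u k < x)%E.
Proof.
rewrite limn_einfE => ux K.
have [|_ [k Kk <-] kx] := @ereal_inf_lt R (u @` [set k | (K <= k)%N]) x; last by exists k.
apply: le_lt_trans ux; apply: ereal_sup_ubound; exists [set k | (K <= k)%N] => //.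
by exists K.
Qed.

Lemma limn_esup_lt u x : (limn_esup u < x)%E -> exists K, forall k, (K <= k)%N -> (u k < x)%E.
Proof.
move=> /ereal_inf_lt[_ [V [K _ KV] <-] xV]; exists K => k Kk.
by apply: le_lt_trans xV; apply: ereal_sup_ubound; exists k => //; exact: KV.
Qed.

Lemma lt_limn_esup u x : (x < limn_esup u)%E -> forall K, exists2 k, (K <= k)%N & (x < u k)%E.
Proof.
move=> ux K.
have [|_ [k Kk <-] kx] := @ereal_sup_gt R (u @` [set k | (K <= k)%N]) x; last by exists k.
apply: lt_le_trans ux _; apply: ereal_inf_lbound; exists [set k | (K <= k)%N] => //.
by exists K.
Qed.

End LimitsOfSequences.

Theorem theorem2p7 (R : realType) (a b : nat -> int)
  (a1 : a 1%N = 0)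
  (ab1 : a 1%N <= b 1%N)
  (ab : forall i : nat, (2 <= i)%N -> a i < b i)
  (ba : forall i : nat, (1 <= i)%N -> b i < a i.+1) :
  let X := restricted_digits R a b in
  [/\ hausdorff_dim X = lower_mbox_dim X,
      lower_mbox_dim X = lower_box_dim X &
      lower_box_dim X =
        limn_einf (fun k : nat =>
          ((\sum_(1 <= i < k.+1) (b i - a i))%:~R / (a k.+1)%:~R : R)%:E)]
  /\
  [/\ packing_dim X = upper_mbox_dim X,
      upper_mbox_dim X = upper_box_dim X &
      upper_box_dim X =
        limn_esup (fun k : nat =>
          ((\sum_(1 <= i < k.+1) (b i - a i))%:~R / (b k)%:~R : R)%:E)].
Proof.
move=> X.
have ab' i : (0 < i)%N -> a i <= b i by case: i => // -[|i] _ //; exact/ltW/ab.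
have a_ge0 i : (0 < i)%N -> 0 <= a i.
  case: i => // i _; elim: i => [|i IH]; first by rewrite a1.
  by apply: (le_trans IH); apply: le_trans (ab' _ _) (ltW (ba _ _)).
have b_ge0 i : (0 < i)%N -> 0 <= b i by move=> i0; exact: le_trans (a_ge0 _ i0) (ab' _ i0).
pose A i := `|a i|%N; pose B i := `|b i|%N.
have AE i : (0 < i)%N -> a i = A i by move=> /a_ge0/gez0_abs.
have BE i : (0 < i)%N -> b i = B i by move=> /b_ge0/gez0_abs.
have A1 : A 1%N = 0%N by rewrite /A a1.
have AB i : (0 < i)%N -> (A i <= B i)%N by move=> i0; rewrite -lez_nat -AE // -BE // ab'.
have BA i : (0 < i)%N -> (B i < A i.+1)%N by move=> i0; rewrite -ltz_nat -AE // -BE // ba.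
pose free n := ~~ `[< exists2 i, (0 < i)%N & (B i < n <= A i.+1)%N >].
have freeP n : reflect (exists2 i, (0 < i)%N & (B i < n <= A i.+1)%N) (~~ free n).
  by rewrite negbK; exact: asboolP.
have XE : X = digit_set R free.
  apply/seteqP; split=> x [xi [xi0 xix]]; exists xi; split=> //.
    move=> n n0 /freeP[i i0 /andP[h1 h2]]; apply: (xi0 n i) => //.
    by rewrite BE // AE // lez_nat h2 andbT -PoszD lez_nat addn1.
  move=> n i i0; rewrite BE // AE // -PoszD !lez_nat addn1 => h.
  apply: xi0; first by case/andP: h; lia.
  by apply/freeP; exists i.
set inf_ := limn_einf _; set sup_ := limn_esup _.
have A_gt0 k : (0 < k)%N -> 0 < (A k.+1)%:R :> R.
  by move=> k0; rewrite ltr0n; exact: leq_ltn_trans (BA _ k0).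
have B_gt0 k : (1 < k)%N -> 0 < (B k)%:R :> R.
  move=> k1; rewrite ltr0n -ltz_nat -BE ?(ltnW k1) //.
  by apply: le_lt_trans (ab _ k1); rewrite a_ge0 ?(ltnW k1).
have MB k : (0 < k)%N -> (\sum_(1 <= i < k.+1) (b i - a i))%:~R = (nfree free (B k))%:R :> R.
  move=> k0; rewrite (nfree_block_sum A1 AB BA freeP) // [RHS]pmulrn; congr (_%:~R).
  rewrite (big_morph Posz PoszD (id1 := 0)) // !big_nat; apply: eq_bigr => i /andP[i0 _].
  by rewrite BE // AE // -subzn ?AB.
have MA k : (0 < k)%N -> nfree free (A k.+1) = nfree free (B k).
  by move=> k0; apply: (nfree_from_b freeP) => //; rewrite leqnn andbT ltnW ?BA.
have inf_low (s : R) : (s%:E < inf_)%E ->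
    exists n0, forall n, (n0 <= n)%N -> s * n%:R <= (nfree free n)%:R.
  move=> /lt_limn_einf[K hK]; apply: (nfree_ge_of_gap_ends A1 AB BA freeP (K := K.+1)) => k Kk.
  have k0 : (0 < k)%N by lia.
  have := hK k (ltnW Kk); rewrite lte_fin MB // -MA // AE //.
  by rewrite ltr_pdivlMr ?A_gt0 // => /ltW.
have inf_up (s : R) : (inf_ < s%:E)%E ->
    forall n0, exists2 n, (n0 <= n)%N & (nfree free n)%:R <= s * n%:R.
  move=> /limn_einf_lt h n0; have [k nk] := h n0.+1; have k0 : (0 < k)%N by lia.
  rewrite lte_fin MB // -MA // AE // ltr_pdivrMr ?A_gt0 // => /ltW hk.
  by exists (A k.+1) => //; apply: leq_trans (ltnW nk) (a_ge AB BA _).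
have sup_up (s : R) : (sup_ < s%:E)%E ->
    exists n0, forall n, (n0 <= n)%N -> (nfree free n)%:R <= s * n%:R.
  move=> /limn_esup_lt[K hK]; apply: (nfree_le_of_run_ends A1 AB BA freeP (K := K.+2)) => k Kk.
  have k0 : (0 < k)%N by lia.
  have := hK k (ltac:(lia)); rewrite lte_fin MB // BE //.
  by rewrite ltr_pdivrMr ?B_gt0 //; [move/ltW|lia].
have sup_low (s : R) : (s%:E < sup_)%E ->
    forall n0, exists2 n, (n0 <= n)%N & s * n%:R <= (nfree free n)%:R.
  move=> /lt_limn_esup h n0; have [k nk] := h n0.+2; have k0 : (0 < k)%N by lia.
  rewrite lte_fin MB // BE // ltr_pdivlMr ?B_gt0 //; last by lia.
  move=> /ltW hk; exists (B k) => //; apply: leq_trans (AB _ k0).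
  by rewrite -(prednK k0); apply: leq_trans (a_ge AB BA _); lia.
have H_ge : (inf_ <= hausdorff_dim X)%E.
  by rewrite XE; apply: lee_of_lt_reals => s /inf_low[n0]; exact: digit_set_hausdorff_ge.
have H_le : (hausdorff_dim X <= inf_)%E.
  by rewrite XE; apply: lee_of_gt_reals => s /inf_up; exact: digit_set_hausdorff_le.
have LM_ge : (inf_ <= lower_mbox_dim X)%E.
  by rewrite XE; apply: lee_of_lt_reals => s /inf_low[n0]; exact: digit_set_lower_mbox_dim_ge.
have LM_le : (lower_mbox_dim X <= lower_box_dim X)%E by rewrite XE; exact: digit_set_lower_mbox_dim_le.
have LB_le : (lower_box_dim X <= inf_)%E.
  by rewrite XE; apply: lee_of_gt_reals => s /inf_up; exact: digit_set_lower_box_dim_le.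
have P_ge : (sup_ <= packing_dim X)%E.
  by rewrite XE; apply: lee_of_lt_reals => s /sup_low; exact: digit_set_packing_ge.
have P_le : (packing_dim X <= sup_)%E.
  by rewrite XE; apply: lee_of_gt_reals => s /sup_up[n0]; exact: digit_set_packing_le.
have UM_ge : (sup_ <= upper_mbox_dim X)%E.
  by rewrite XE; apply: lee_of_lt_reals => s /sup_low; exact: digit_set_upper_mbox_dim_ge.
have UM_le : (upper_mbox_dim X <= upper_box_dim X)%E by rewrite XE; exact: digit_set_upper_mbox_dim_le.
have UB_le : (upper_box_dim X <= sup_)%E.
  by rewrite XE; apply: lee_of_gt_reals => s /sup_up[n0]; exact: digit_set_upper_box_dim_le.
have -> : hausdorff_dim X = inf_ by apply/le_anti; rewrite H_le H_ge.
have -> : packing_dim X = sup_ by apply/le_anti; rewrite P_le P_ge.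
have -> : lower_box_dim X = inf_.
  by apply/le_anti; rewrite LB_le (le_trans LM_ge).
have -> : upper_box_dim X = sup_.
  by apply/le_anti; rewrite UB_le (le_trans UM_ge).
have -> : lower_mbox_dim X = inf_.
  by apply/le_anti; rewrite LM_ge (le_trans LM_le).
have -> : upper_mbox_dim X = sup_.
  by apply/le_anti; rewrite UM_ge (le_trans UM_le).
by [].
Qed.
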